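(* Let $\mathscr{B}\subseteq\mathbb{N}$ be such that $\eta^*$ is a regular Toeplitz sequence. Then $$\mathcal{P}(X_\eta)=\mathcal{P}(X_\varphi)=\{N_\ast((\nu_{\eta^*}\triangle\nu_\eta)\vee\kappa):\kappa\in\mathcal{P}(\{0,1\}^{\mathbb{Z}})\},$$ where $N:(\{0,1\}^{\mathbb{Z}})^3\to\{0,1\}^{\mathbb{Z}}$ is the map $N(w,x,y)=w+y\cdot(x-w)$ (coordinatewise operations), $\nu_{\eta^*}\triangle\nu_\eta$ is the joining of $\nu_{\eta^*}$ with $\nu_\eta$ for which the pair $(\eta^*,\eta)$ is quasi-generic along any sequence $(\ell_i)$ realizing the lower density of $\mathcal{M}_{\mathscr{B}}$, and on the right-hand side $\kappa$ ranges over all $\sigma$-invariant Borel probability measures on $\{0,1\}^{\mathbb{Z}}$ and $(\nu_{\eta^*}\triangle\nu_\eta)\vee\kappa$ ranges over all joinings of $\nu_{\eta^*}\triangle\nu_\eta$ and $\kappa$.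
   Context: $\mathbb{N}=\{1,2,\dots\}$. For $\mathscr{A}\subseteq\mathbb{N}$: $\mathcal{M}_{\mathscr{A}}=\bigcup_{a\in\mathscr{A}}a\mathbb{Z}$, $\mathcal{F}_{\mathscr{A}}=\mathbb{Z}\setminus\mathcal{M}_{\mathscr{A}}$, and $\mathscr{A}^{prim}$ is the set of those $a\in\mathscr{A}$ not divisible by any other element of $\mathscr{A}$. Put $\eta=\mathbf{1}_{\mathcal{F}_{\mathscr{B}}}\in\{0,1\}^{\mathbb{Z}}$. Let $\sigma$ be the left shift on $\{0,1\}^{\mathbb{Z}}$; $X_\eta$ is the closure of $\{\sigma^k\eta:k\in\mathbb{Z}\}$. For a closed $\sigma$-invariant $X\subseteq\{0,1\}^{\mathbb{Z}}$, $\mathcal{P}(X)$ is the set of $\sigma$-invariant Borel probability measures on $X$. $\mathscr{B}^*=(\mathscr{B}\cup D)^{prim}$, where $D=\{d\in\mathbb{N}: d\mathcal{A}\subseteq\mathscr{B}\text{ for some infinite pairwise coprime set }\mathcal{A}\subseteq\mathbb{N}\}$, and $\eta^*=\mathbf{1}_{\mathcal{F}_{\mathscr{B}^*}}$. A sequence $x\in\{0,1\}^{\mathbb{Z}}$ is Toeplitz if for each $i\in\mathbb{Z}$ there is $s\in\mathbb{N}$ with $x(i+sk)=x(i)$ for all $k\in\mathbb{Z}$. Let $\mathrm{Per}(x,s)=\{i\in\mathbb{Z}: x(i+sk)=x(i)\text{ for all }k\in\mathbb{Z}\}$. A Toeplitz sequence $x$ is regular if $\lim_{r\to\infty}d\big(\bigcup_{s\le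 r}\mathrm{Per}(x,s)\big)=1$, where $d(A)=\lim_{L\to\infty}\frac1L|A\cap[1,L]|$. (The sequence $\eta^*$ is always Toeplitz.) A sequence $(\ell_i)$ of positive integers tending to infinity realizes the lower density of a set $A$ if $\lim_i\frac1{\ell_i}|A\cap[1,\ell_i]|=\underline{d}(A):=\liminf_{L\to\infty}\frac1L|A\cap[1,L]|$. For a homeomorphism $T$ of a compact metric space, a point $x$ is quasi-generic for $\mu$ along $(\ell_i)$ if $\frac1{\ell_i}\sum_{1\le\ell\le\ell_i}\delta_{T^\ell x}\to\mu$ weakly; for the pair $(\eta^*,\eta)$, $T=\sigma\times\sigma$ on $(\{0,1\}^{\mathbb{Z}})^2$. The Mirsky measure $\nu_\eta$ is the measure for which $\eta$ is quasi-generic along any sequence realizing the lower density of $\mathcal{M}_{\mathscr{B}}$ (it is known to exist and not to depend on the sequence); $\nu_{\eta^*}$ is defined in the same way from $\mathscr{B}^*$. For $\mathscr{B}$ as in the claim, the limit measure $\nu_{\eta^*}\triangle\nu_\eta$ exists and does not depend on $(\ell_i)$. Let $G=\prod_{b\in\mathscr{B}}\mathbb{Z}/b\mathbb{Z}$, $\Delta:\mathbb{Z}\to G$, $\Delta(n)=(n,n,\dots)$, $H=\overline{\Delta(\mathbb{Z})}$, $W=\{h\in H:h_b\ne0\text{ for each }b\in\mathscr{B}\}$, $\varphi:H\to\{0,1\}^{\mathbb{Z}}$, $\varphi(h)(n)=1\iff h+\Delta(n)\in W$, and $X_\varphi=\overline{\varphi(H)}$. A joining of two invariant measures $\mu_1,\mu_2$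 (for $T_1,T_2$) is any $(T_1\times T_2)$-invariant Borel probability measure on the product with marginals $\mu_1,\mu_2$; here $(\nu_{\eta^*}\triangle\nu_\eta)\vee\kappa$ is a $\sigma^{\times3}$-invariant measure on $(\{0,1\}^{\mathbb{Z}})^3$. $f_\ast$ denotes push-forward of measures. *)

(* Defs.v *)
From HB Require Import structures.
From mathcomp Require Import all_boot all_order all_algebra.
From mathcomp Require Import all_classical all_reals all_analysis.

Set Implicit Arguments.
Unset Strict Implicit.
Unset Printing Implicit Defensive.

Import Order.TTheory GRing.Theory Num.Theory.
Import numFieldTopology.Exports numFieldNormedType.Exports.

Local Open Scope classical_set_scope.
Local Open Scope ring_scope.

(** The full shift {0,1}^Z, with the product topology. *)

Definition binseq : Type := prod_topology (fun _ : int => bool).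

HB.instance Definition _ := Pointed.on binseq.
HB.instance Definition _ := Nbhs.on binseq.
HB.instance Definition _ := Topological.on binseq.
HB.instance Definition _ := Uniform.on binseq.

Definition zshift (k : int) (x : binseq) : binseq := fun n => x (n + k).

Definition sigma : binseq -> binseq := zshift 1.

(** Sets of multiples.  Subsets of N = {1, 2, ...} are sets of [nat] not
    containing 0. *)

Definition positives : set nat := [set n | (0 < n)%N].

Definition multiples (A : set nat) : set int :=
  [set n | exists2 a, A a & (a%:Z %| n)%Z].

Definition free_integers (A : set nat) : set int := ~` multiples A.

Definition primitive_part (A : set nat) : set nat :=
  [set a | A a /\ forall a', A a' -> (a' %| a)%N -> a' = a].

Definition pairwise_coprime (A : set nat) : Prop :=
  forall a a', A a -> A a' -> a <> a' -> coprime a a'.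

Definition coprime_scalings (B : set nat) : set nat :=
  [set d | (0 < d)%N /\
     exists A : set nat, [/\ A `<=` positives, infinite_set A,
       pairwise_coprime A & forall a, A a -> B (d * a)%N]].

Definition bstar (B : set nat) : set nat :=
  primitive_part (B `|` coprime_scalings B).

Definition eta_seq (B : set nat) : binseq := fun n => n \in free_integers B.

Definition eta_star (B : set nat) : binseq := eta_seq (bstar B).

Definition X_eta (B : set nat) : set binseq :=
  closure (range (fun k => zshift k (eta_seq B))).

(** The group G = \prod_(b in B) Z/bZ, as a topological space.  For [0 < b] the
    type ['I_b.-1.+1] is ['I_b]; unlike ['Z_b] it is trivial when b = 1. *)

Definition residues (b : nat) : Type := 'I_b.-1.+1.
HB.instance Definition _ (b : nat) := GRing.Zmodule.on (residues b).

Definition prod_residues (B : set nat) : Type :=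
  prod_topology (fun b : B => discrete_topology (residues (val b))).
HB.instance Definition _ (B : set nat) := Topological.on (prod_residues B).

Definition residue (b : nat) (n : int) : residues b :=
  (inZp 1 : residues b) *~ n.
Arguments residue b n : clear implicits.

Definition Delta (B : set nat) (n : int) : prod_residues B :=
  fun b => residue (val b) n.
Arguments Delta B n : clear implicits.

Definition translate (B : set nat) (h : prod_residues B) (n : int) :
    prod_residues B :=
  fun b => (h b : residues (val b)) + (Delta B n b : residues (val b)).

Definition H_group (B : set nat) : set (prod_residues B) :=
  closure (range (Delta B)).
Arguments H_group B : clear implicits.

Definition window (B : set nat) : set (prod_residues B) :=
  [set h | H_group B h /\ forall b : B, (h b : residues (val b)) != 0].
Arguments window B : clear implicits.

Definition phi (B : set nat) (h : prod_residues B) : binseq :=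
  fun n => translate h n \in window B.

Definition X_phi (B : set nat) : set binseq :=
  closure (@phi B @` H_group B).

(** Densities of sets of integers along [1, L]. *)

Section densities.
Context (R : realType).

Definition freq (A : set int) (L : nat) : R :=
  (\sum_(1 <= n < L.+1) (n%:Z \in A))%N%:R / L%:R.

(** Only applied to periodic sets, for which the limit exists. *)
Definition density (A : set int) : R := lim (freq A L @[L --> \oo]).

Definition lower_density (A : set int) : R := limn_inf (freq A).

Definition realizes_lower_density (ell : nat -> nat) (A : set int) : Prop :=
  [/\ forall i, (0 < ell i)%N,
      ell i @[i --> \oo] --> \oo &
      freq A (ell i) @[i --> \oo] --> lower_density A].

End densities.

(** Toeplitz sequences. *)

Definition toeplitz (x : binseq) : Prop :=
  forall i : int, exists2 s : nat, (0 < s)%N &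
    forall k : int, x (i + s%:Z * k) = x i.

Definition Per (x : binseq) (s : nat) : set int :=
  [set i | forall k : int, x (i + s%:Z * k) = x i].

Definition regular_toeplitz (R : realType) (x : binseq) : Prop :=
  toeplitz x /\
  density R (\bigcup_(s in [set s | (1 <= s <= r)%N]) Per x s) @[r --> \oo]
    --> (1 : R).

(** Invariant Borel probability measures, joinings and quasi-generic points.
    Measures are functions on all subsets, so they are only ever compared on
    Borel sets. *)

HB.instance Definition _ (X Y : ptopologicalType) :=
  Topological.on (X * Y)%type.

Definition borel (X : ptopologicalType) : Type := g_sigma_algebraType (@open X).
HB.instance Definition _ (X : ptopologicalType) := Measurable.on (borel X).

Definition prod_map (X Y : Type) (S : X -> X) (T : Y -> Y) :
    X * Y -> X * Y := fun p => (S p.1, T p.2).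

Section dynamics.
Context (R : realType).

Definition is_pushforward (X Y : ptopologicalType) (f : X -> Y)
    (mu : probability (borel X) R) (nu : probability (borel Y) R) : Prop :=
  forall A : set (borel Y), measurable A ->
    nu A = pushforward mu (f : borel X -> borel Y) A.

Definition invariant (X : ptopologicalType) (T : X -> X)
  (mu : probability (borel X) R) : Prop := is_pushforward T mu mu.

(** Measures on a closed set [X] are identified with the measures on the full
    shift giving mass 1 to [X]. *)
Definition invariant_measures (X : set binseq) :
    set (probability (borel binseq) R) :=
  [set mu | invariant sigma mu /\ mu X = 1%E].

Definition joining (X Y : ptopologicalType) (S : X -> X) (T : Y -> Y)
    (mu : probability (borel X) R) (nu : probability (borel Y) R)
    (lambda : probability (borel (X * Y)%type) R) : Prop :=
  [/\ invariant (prod_map S T) lambda,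
      is_pushforward (fst : X * Y -> X) lambda mu &
      is_pushforward (snd : X * Y -> Y) lambda nu].

(** The left-hand side of the limit is the integral of [f] against
    (1 / ell i) * \sum_(1 <= l <= ell i) dirac (T^l x).  The definition is used
    on compact spaces, where all continuous functions are bounded. *)
Definition quasi_generic (X : ptopologicalType) (T : X -> X) (x : X)
    (ell : nat -> nat) (mu : probability (borel X) R) : Prop :=
  forall f : X -> R, continuous f ->
    (ell i)%:R^-1 * \sum_(1 <= l < (ell i).+1) f (iter l T x) @[i --> \oo]
      --> (\int[mu]_y f y : R).

(** The next two definitions select a measure by its defining property; it
    exists, and that property determines it on Borel sets. *)

Definition mirsky (B : set nat) : probability (borel binseq) R :=
  get [set nu | forall ell, realizes_lower_density R ell (multiples B) ->
                  quasi_generic sigma (eta_seq B) ell nu].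

(** The joining of the Mirsky measures of [bstar B] and [B] generated by the
    pair of sequences.  Both coordinates use sequences realizing the lower
    density of the multiples of [B].  Existence relies on [eta_star B] being a
    regular Toeplitz sequence. *)
Definition mirsky_pair (B : set nat) :
    probability (borel (binseq * binseq)%type) R :=
  get [set rho |
        joining sigma sigma (mirsky (bstar B)) (mirsky B) rho /\
        forall ell, realizes_lower_density R ell (multiples B) ->
          quasi_generic (prod_map sigma sigma) (eta_star B, eta_seq B) ell rho].

End dynamics.
Arguments invariant_measures R X : clear implicits.
Arguments mirsky R B : clear implicits.
Arguments mirsky_pair R B : clear implicits.

(** The map (w, x, y) |-> w + y * (x - w), see [mixE]. *)
Definition mix (p : binseq * binseq * binseq) : binseq :=
  fun n => if p.2 n then p.1.2 n else p.1.1 n.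

Lemma mixE (w x y : binseq) (n : int) :
  (mix (w, x, y) n : nat)%:Z =
  (w n : nat)%:Z + (y n : nat)%:Z * ((x n : nat)%:Z - (w n : nat)%:Z).
Proof. by rewrite /mix /=; case: (w n); case: (x n); case: (y n). Qed.

(* Main.v *)
Require Import Defs.
From HB Require Import structures.
From mathcomp Require Import all_boot all_order all_algebra.
From mathcomp Require Import all_classical all_reals all_analysis.
From mathcomp Require Import measurable_realfun.
From mathcomp Require Import zify ring lra.

Set Implicit Arguments.
Unset Strict Implicit.
Unset Printing Implicit Defensive.

Import Order.TTheory GRing.Theory Num.Theory.
Import numFieldTopology.Exports numFieldNormedType.Exports.

Local Open Scope classical_set_scope.
Local Open Scope ring_scope.

(** Let w_j be the sequence that agrees with eta_star at its positions of
    period at most j and vanishes elsewhere, and let z_j be the indicator of the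
    integers free of the elements of B up to j.  Both have period j!, and
    w_j <= eta_star <= eta <= z_j.  The proof rests on these periodic bounds.

    They are tight.  The positions where w_j and eta_star differ have small
    density because eta_star is a regular Toeplitz sequence.  The positions where
    z_j and eta differ have small frequency along every sequence realizing the
    lower density of the multiples of B: this is the theorem of Davenport and
    Erdos ([davenport_erdos]), by which that lower density is the limit of the
    densities of the multiples of the finite parts of B.  Hence the pair
    (eta_star, eta) is quasi-generic for the limit of the invariant measures
    carried by the periodic pairs (w_j, z_j), and this limit is the joining of
    the two Mirsky measures ([mirsky_pair_spec]).

    Every invariant measure mu on X_phi is a mixture.  A point x of X_phi lies,
    for each j, between one and the same shift of w_j and of z_j
    ([X_phi_sandwich]).  Choosing such a shift as a function of x couples mu with
    the orbit of (w_j, z_j); averaging along the orbit and letting j grow gives a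
    joining of the Mirsky pair with mu under which w <= x <= z almost surely.  Then
    w + x (z - w) = x, so that kappa = mu works ([X_phi_coupling]).

    Every mixture lives on X_eta ([mix_joining_X_eta]).  A pattern seen with
    positive probability in a mixture takes its values between those of eta_star
    and eta at a set of places of positive frequency, and then it occurs in eta
    ([pattern_occurs]).  Indeed, where it has a zero and eta has a one, the place
    is a multiple of some d such that d a belongs to B for infinitely many
    pairwise coprime a.  By the Chinese remainder theorem the pattern can be moved
    to places where it meets multiples of such products d a, for pairwise coprime
    a without small prime factors.  The ones of the pattern survive at many of
    these places: the elements of B coprime to all chosen a impose conditions
    independent of the move, and an element of B sharing a prime p with a chosen a
    cannot divide a one, as p would then divide the distance between two places
    of the pattern.

    Finally X_eta is contained in X_phi because the shifts of eta are the images
    under phi of the points Delta k, which closes the circle of inclusions.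

    Measures on the full shift and its powers are handled through clopen sets:
    finitely additive functions of clopen sets extend to Borel measures
    ([clopen_extension]), Borel probabilities are determined by clopen sets
    ([is_pushforward_clopen]), and quasi-genericity is the convergence of the
    frequencies of visits to clopen sets ([quasi_generic_clopen]). *)

(** * Compact spaces with a countable system of clopen partitions *)

(** E n x is the set of the points that agree with x up to precision n.
    Windows give such a system of clopen equivalence relations on the full
    shift, and products inherit it. *)
Structure resolution (X : topologicalType) (E : nat -> X -> set X) : Prop := {
  res_refl : forall n x, E n x x;
  res_sym : forall n x y, E n x y -> E n y x;
  res_trans : forall n x y z, E n x y -> E n y z -> E n x z;
  res_mono : forall n m x y, (n <= m)%N -> E m x y -> E n x y;
  res_nbhs : forall n x, nbhs x (E n x);
  res_base : forall x U, nbhs x U -> exists n, E n x `<=` U }.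

Section resolutions.
Context (X : ptopologicalType) (E : nat -> X -> set X).
Hypothesis rE : resolution E.

Definition saturated n (A : set X) := forall x y, E n x y -> A x -> A y.

Lemma saturated_open n A : saturated n A -> open A.
Proof.
move=> sA; rewrite openE => x Ax.
by apply: filterS (res_nbhs rE n x) => y Exy; exact: sA Exy Ax.
Qed.

Lemma saturatedC n A : saturated n A -> saturated n (~` A).
Proof. by move=> sA x y /(res_sym rE) Eyx nAx Ay; apply/nAx/(sA _ _ Eyx). Qed.

Lemma saturated_clopen n A : saturated n A -> clopen A.
Proof.
move=> sA; split; first exact: saturated_open sA.
by rewrite -openC; apply: (@saturated_open n); exact: saturatedC.
Qed.

Lemma saturated_cell n x : saturated n (E n x).
Proof. by move=> y z Eyz Exy; apply: res_trans rE _ _ _ _ Exy Eyz. Qed.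

Lemma saturatedI n A B : saturated n A -> saturated n B -> saturated n (A `&` B).
Proof. by move=> sA sB x y Exy [/(sA _ _ Exy) ? /(sB _ _ Exy)]. Qed.

Definition inner_part n (U : set X) : set X := [set x | E n x `<=` U].

Lemma inner_part_saturated n U : saturated n (inner_part n U).
Proof. by move=> x y Exy Ux z Eyz; apply/Ux/(res_trans rE Exy Eyz). Qed.

Lemma inner_part_sub n U : inner_part n U `<=` U.
Proof. by move=> x; apply; exact: res_refl. Qed.

(** As the inner parts are clopen, the clopen sets generate the Borel sets. *)
Lemma bigcup_inner_part U : open U -> U = \bigcup_n inner_part n U.
Proof.
move=> oU; apply/seteqP; split=> [x Ux|x [n _ /inner_part_sub//]].
by have [n sub] := res_base rE (open_nbhs_nbhs (conj oU Ux)); exists n.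
Qed.

Hypothesis cX : compact [set: X].

(** Compactness turns precisions that depend on the point into a single one.
    Applied to clopen sets it yields their description by a finite window, and
    applied to continuous functions their uniform continuity. *)
Lemma resolution_uniform (P : X -> X -> Prop) :
  (forall x, exists n, forall y z, E n x y -> E n x z -> P y z) ->
  exists n, forall y z, E n y z -> P y z.
Proof.
move=> loc; have /compact_near_coveringP := cX.
move=> /(_ nat \oo (fun n y => forall z, E n y z -> P y z) _).
case=> [x _|N _ sN].
  have [n xP] := loc x; exists (E n x, [set m | (n <= m)%N]).
    by split=> /=; [exact: res_nbhs|exists n].
  case=> y m /= [Exy nm] z /(res_mono rE nm) Eyz; apply: xP => //.
  exact: res_trans rE _ _ _ _ Exy Eyz.
by exists N => y z; apply: (sN N) => /=.
Qed.

Lemma clopen_saturated A : clopen A -> exists n, saturated n A.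
Proof.
move=> [oA cA]; apply: resolution_uniform => x.
case: (pselect (A x)) => [Ax|nAx].
  have [n sub] := res_base rE (open_nbhs_nbhs (conj oA Ax)).
  by exists n => y z _ /sub.
have oC : open (~` A) by rewrite openC.
have [n sub] := res_base rE (open_nbhs_nbhs (conj oC nAx)).
by exists n => y z /sub.
Qed.

Lemma finite_cells n : exists s : seq X, forall x, exists2 y, y \in s & E n y x.
Proof.
have := cX; rewrite compact_cover => /(_ X setT (fun x => (E n x)^°)).
case=> [x _|x _|D _ cD]; first exact: open_interior.
  by exists x => //; exact: res_nbhs.
exists (finmap.enum_fset D) => x; have [y yD /interior_subset Eyx] := cD x I.
by exists y.
Qed.

End resolutions.

(** * Borel probabilities and clopen sets *)

Lemma borel_open (X : ptopologicalType) (U : set X) :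
  open U -> measurable (U : set (borel X)).
Proof. exact: sub_sigma_algebra. Qed.

Lemma borel_closed (X : ptopologicalType) (U : set X) :
  closed U -> measurable (U : set (borel X)).
Proof.
rewrite -openC => /borel_open/measurableC; by rewrite setCK.
Qed.

Lemma borel_clopen (X : ptopologicalType) (U : set X) :
  clopen U -> measurable (U : set (borel X)).
Proof. by case=> /borel_open. Qed.

Lemma borel_generated (X : ptopologicalType) (E : nat -> X -> set X) :
  resolution E -> @measurable _ (borel X) = <<s @clopen X >>.
Proof.
move=> rE; rewrite eqEsubset; split.
  apply: smallest_sub; first exact: smallest_sigma_algebra.
  move=> U oU; rewrite (bigcup_inner_part rE oU).
  apply: (@bigcupT_measurable _ (g_sigma_algebraType (@clopen X))) => n.
  apply: sub_sigma_algebra; apply: (saturated_clopen rE (n := n)).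
  exact: inner_part_saturated.
apply: smallest_sub; first exact: smallest_sigma_algebra.
by move=> U /borel_clopen.
Qed.

(** A copy of X whose measurable sets are the clopen sets. *)
Definition clopen_algebra (X : ptopologicalType) : Type := X.
HB.instance Definition _ (X : ptopologicalType) :=
  Pointed.on (clopen_algebra X).

Lemma clopen_setC_closed (X : ptopologicalType) : setC_closed (@clopen X).
Proof. by move=> A; exact: clopenC. Qed.

HB.instance Definition _ (X : ptopologicalType) :=
  @isAlgebraOfSets.Build default_measure_display (clopen_algebra X)
    (@clopen X) (@clopen0 X) (@clopenU X) (@clopen_setC_closed X).

Section extension.
Context (R : realType) (X : ptopologicalType) (E : nat -> X -> set X).
Hypotheses (rE : resolution E) (cX : compact [set: X]).
Variable m : set X -> R.
Hypotheses (m_ge0 : forall A, clopen A -> 0 <= m A) (mT : m setT = 1).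
Hypothesis mU : forall A B, clopen A -> clopen B -> A `&` B = set0 ->
  m (A `|` B) = m A + m B.

Let mu (A : set (clopen_algebra X)) : \bar R :=
  (if pselect (@clopen X A) then m A else 0)%:E.

Let muE A : @clopen X A -> mu A = (m A)%:E.
Proof. by rewrite /mu; case: pselect. Qed.

Let mu0 : mu set0 = 0%E.
Proof.
rewrite muE; last exact: clopen0.
have := mU clopen0 clopen0 (setI0 set0); rewrite setU0 => /eqP.
by rewrite -subr_eq0 opprD addrA subrr sub0r oppr_eq0 => /eqP ->.
Qed.

Let mu_ge0 A : (0 <= mu A)%E.
Proof. by rewrite /mu; case: pselect => //= cA; rewrite lee_fin m_ge0. Qed.

Let mu_additive2 A B : @clopen X A -> @clopen X B -> A `&` B = set0 ->
  mu (A `|` B) = (mu A + mu B)%E.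
Proof. by move=> cA cB AB; rewrite !muE ?mU//; exact: clopenU. Qed.

Let clopen_bigU (F : (set X)^nat) n : (forall i, clopen (F i)) ->
  clopen (\big[setU/set0]_(i < n) F i).
Proof.
move=> cF; elim/big_ind: _ => //; [exact: clopen0|exact: clopenU].
Qed.

Let mu_additive (F : (set X)^nat) n : (forall i, clopen (F i)) ->
  trivIset setT F ->
  mu (\big[setU/set0]_(i < n) F i) = (\sum_(i < n) mu (F i))%E.
Proof.
move=> cF tF; elim: n => [|n IH]; first by rewrite !big_ord0.
rewrite !big_ord_recr/= mu_additive2 ?IH//; first exact: clopen_bigU.
rewrite big_distrl/= big1// => i _; apply/eqP.
move/trivIsetP: tF => -> //; by rewrite neq_ltn ltn_ord.
Qed.

Let mu_sigma_additive : semi_sigma_additive mu.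
Proof.
move=> F cF tF cUF.
have [N FN] : exists N, forall i, (N <= i)%N -> F i = set0.
  have : compact (\bigcup_i F i).
    by apply: (subclosed_compact _ cX) => //; case: cUF.
  rewrite compact_cover => /(_ nat setT F) [||D _ cD] //.
    by move=> i _; case: (cF i).
  exists (\max_(i <- finmap.enum_fset D) i).+1 => i Di; rewrite -subset0 => x Fix.
  have [j jD Fjx] := cD x (ex_intro2 _ _ i I Fix).
  have ij : i = j.
    by apply: contrapT => /eqP ij; move/trivIsetP: tF => /(_ i j I I ij);
      apply/eqP/set0P; exists x.
  have : (j <= \max_(k <- finmap.enum_fset D) k)%N.
    by rewrite (big_rem j)//= leq_maxl.
  by rewrite -ij leqNgt Di.
have eqS n : (N <= n)%N -> (\sum_(0 <= i < n) mu (F i))%E = mu (\bigcup_n F n).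
  move=> Nn; rewrite big_mkord -mu_additive//; congr mu.
  rewrite -bigcup_mkord; apply/seteqP; split=> x [i _ Fix]; exists i => //=.
  by rewrite ltnNge; apply/negP => ni; move: Fix; rewrite FN// (leq_trans Nn).
apply: cvg_near_cst; near=> n; apply: eqS; near: n; by exists N.
Unshelve. all: by end_near.
Qed.

HB.instance Definition _ := isMeasure.Build _ _ R mu mu0 mu_ge0
  mu_sigma_additive.

Let nu : set (borel X) -> \bar R := measure_extension mu.

Let borel_ext (A : set X) : measurable (A : set (borel X)) ->
  (default_measure_display.-measurable).-sigma.-measurable
    (A : set (g_sigma_algebraType (@measurable _ (clopen_algebra X)))).
Proof. by rewrite (borel_generated rE). Qed.

Let nu0 : nu set0 = 0%E. Proof. exact: (measure0 (measure_extension mu)). Qed.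

Let nu_ge0 A : (0 <= nu A)%E. Proof. exact: (measure_ge0 (measure_extension mu)). Qed.

Let nu_sigma_additive : semi_sigma_additive nu.
Proof.
move=> F mF tF mUF.
apply: (measure_semi_sigma_additive (s := measure_extension mu)) => //.
  by move=> i; apply: borel_ext.
exact: borel_ext.
Qed.

HB.instance Definition _ := isMeasure.Build _ _ R nu nu0 nu_ge0
  nu_sigma_additive.

Let nuE A : @clopen X A -> nu A = (m A)%:E.
Proof. by move=> cA; rewrite -(muE cA); exact: (@measurable_mu_extE _ _ _ mu A). Qed.

Let nuT : nu setT = 1%E.
Proof. by rewrite nuE ?mT//; exact: clopenT. Qed.

HB.instance Definition _ := Measure_isProbability.Build _ _ R nu nuT.

(** A disjoint union of clopen sets that is itself clopen is compact, so that
    all but finitely many of the sets are empty. Hence finite additivity on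
    clopen sets is already sigma-additivity, and the extension theorem of
    Caratheodory applies. *)
Lemma clopen_extension : exists P : probability (borel X) R,
  forall A, clopen A -> P A = (m A)%:E.
Proof. by exists nu. Qed.

End extension.

Lemma borel_preimage (X Y : ptopologicalType) (f : X -> Y) :
  continuous f -> forall A : set (borel Y), measurable A ->
  measurable (f @^-1` A : set (borel X)).
Proof.
move=> /continuousP cf A mA.
pose G : set (set Y) := [set A | measurable (f @^-1` A : set (borel X))].
suff : <<s @open Y >> `<=` G by apply.
apply: smallest_sub => [|U oU]; last by apply: borel_open; exact: cf.
split; rewrite /G/=.
- by rewrite preimage_set0; exact: measurable0.
- by move=> B mB; rewrite setTD preimage_setC; exact: measurableC.
- by move=> F mF; rewrite preimage_bigcup; exact: bigcupT_measurable.
Qed.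

Section clopen_determined.
Context (R : realType) (X Y : ptopologicalType) (E : nat -> Y -> set Y).
Hypothesis rE : resolution E.

(** The clopen sets are stable under intersection and generate the Borel sets,
    so that Dynkin's lemma applies. *)
Lemma is_pushforward_clopen (f : X -> Y) (P : probability (borel X) R)
    (Q : probability (borel Y) R) : continuous f ->
  (forall A, clopen A -> Q A = P (f @^-1` A)) -> is_pushforward f P Q.
Proof.
move=> cf PQ A mA.
apply: (@dynkin_induction _ (borel Y) (@clopen Y)
  (fun S => Q S = pushforward P (f : borel X -> borel Y) S)).
- exact: borel_generated rE.
- by move=> B C; exact: clopenI.
- by rewrite /pushforward preimage_setT !probability_setT.
- by move=> B cB; rewrite /pushforward PQ.
- move=> S mS; rewrite /pushforward preimage_setC => QS.
  by rewrite !probability_setC ?QS//; exact: borel_preimage.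
- move=> F mF tF QF; rewrite /pushforward preimage_bigcup.
  rewrite !measure_bigcup//.
  + apply: eq_eseriesr => i _. exact: QF.
  + by move=> i _; exact: borel_preimage.
  + apply/trivIsetP => i j _ _ ij; rewrite -preimage_setI.
    by move/trivIsetP : tF => ->//; rewrite preimage_set0.
- by rewrite -(borel_generated rE).
Qed.

End clopen_determined.

(** * Quasi-generic points and clopen sets *)

Section orbit_means.
Context (R : realType) (X : ptopologicalType) (T : X -> X) (x : X).

Definition orbit_mean (L : nat) (f : X -> R) : R :=
  L%:R^-1 * \sum_(1 <= l < L.+1) f (iter l T x).

Lemma orbit_meanD L f g :
  orbit_mean L (fun y => f y + g y) = orbit_mean L f + orbit_mean L g.
Proof. by rewrite /orbit_mean big_split/= mulrDr. Qed.

Lemma orbit_meanZ L c f :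
  orbit_mean L (fun y => c * f y) = c * orbit_mean L f.
Proof. by rewrite /orbit_mean -mulr_sumr mulrCA. Qed.

Lemma orbit_mean_le L f c : (forall y, f y <= c) -> 0 <= c ->
  orbit_mean L f <= c.
Proof.
move=> fc c0; rewrite /orbit_mean.
have [->|L0] := posnP L; first by rewrite invr0 mul0r.
rewrite ler_pdivrMl ?ltr0n//.
apply: (@le_trans _ _ (\sum_(1 <= l < L.+1) c)); first exact: ler_sum.
by rewrite sumr_const_nat subSS subn0 mulr_natl.
Qed.

Lemma orbit_mean_dist L f g e : (forall y, `|f y - g y| <= e) ->
  `|orbit_mean L f - orbit_mean L g| <= e.
Proof.
move=> fg; have e0 : 0 <= e by apply: le_trans (fg point); exact: normr_ge0.
have gE c h : orbit_mean L (fun y => c * h y) = c * orbit_mean L h.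
  exact: orbit_meanZ.
rewrite ler_distl; apply/andP; split.
  rewrite lerBlDr -lerBlDl -[X in _ - X]mul1r -mulNr -gE -orbit_meanD.
  apply: orbit_mean_le => // y; rewrite mulN1r.
  by apply: le_trans (fg y); rewrite distrC ler_norm.
rewrite -lerBlDl -[X in _ - X]mul1r -mulNr -gE -orbit_meanD.
apply: orbit_mean_le => // y; rewrite mulN1r.
by apply: le_trans (fg y); rewrite ler_norm.
Qed.

End orbit_means.

Lemma continuous_indic (R : realType) (X : topologicalType) (A : set X) :
  clopen A -> continuous (\1_A : X -> R).
Proof.
move=> [oA cA] x; apply: cvg_near_cst.
case: (pselect (A x)) => Ax.
  have : nbhs x A by apply: open_nbhs_nbhs.
  by apply: filterS => y Ay; rewrite !indicE !mem_set.
have : nbhs x (~` A) by apply: open_nbhs_nbhs; split => //; rewrite openC.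
by apply: filterS => y Ay; rewrite !indicE !memNset.
Qed.

Lemma borel_continuous (R : realType) (X : ptopologicalType) (f : X -> R) :
  continuous f -> measurable_fun [set: borel X] (f : borel X -> R).
Proof.
move=> /continuousP cf; apply: (measurability _ (RGenOpens.measurableE R)).
move=> _ [_ [a [b ->] <-]]; rewrite setTI; apply: borel_open.
exact/cf/interval_open.
Qed.

Lemma Rintegral_indic_borel (R : realType) (X : ptopologicalType)
    (mu : probability (borel X) R) (A : set (borel X)) : measurable A ->
  \int[mu]_y (\1_A y) = fine (mu A).
Proof. by move=> mA; rewrite /Rintegral integral_indic// setIT. Qed.

Lemma integrable_bounded (R : realType) (X : ptopologicalType)
    (mu : probability (borel X) R) (f : borel X -> R) c :
  measurable_fun setT f -> (forall y, `|f y| <= c) ->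
  mu.-integrable setT (EFin \o f).
Proof.
move=> mf fc; apply: measurable_bounded_integrable => //.
  by rewrite (@le_lt_trans _ _ 1%E) ?probability_le1// ltry.
exists c; split; first exact: num_real.
by move=> M cM y _; exact: le_trans (fc y) (ltW cM).
Qed.

Section quasi_generic_clopen.
Context (R : realType) (X : ptopologicalType) (E : nat -> X -> set X).
Hypotheses (rE : resolution E) (cX : compact [set: X]).
Context (T : X -> X) (x : X) (ell : nat -> nat) (mu : probability (borel X) R).

Lemma quasi_generic_indic (C : set X) : clopen C ->
  quasi_generic T x ell mu ->
  orbit_mean T x (ell i) (\1_C : X -> R) @[i --> \oo] --> fine (mu C).
Proof.
move=> cC qg; rewrite -Rintegral_indic_borel; last exact: borel_clopen.
exact/qg/continuous_indic.
Qed.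

Hypothesis clopen_cvg : forall C : set X, clopen C ->
  orbit_mean T x (ell i) (\1_C : X -> R) @[i --> \oo] --> fine (mu C).

Let good (h : X -> R) := [/\ measurable_fun [set: borel X] (h : borel X -> R),
  mu.-integrable setT (EFin \o h : borel X -> \bar R) &
  orbit_mean T x (ell i) h @[i --> \oo] --> (\int[mu]_y (h y) : R)].

Let goodZ c C : clopen C -> good (fun y => c * \1_C y).
Proof.
move=> cC; have mC := borel_clopen cC.
have mf : measurable_fun [set: borel X] (\1_C : borel X -> R).
  by apply: borel_continuous; exact: continuous_indic.
have inf : mu.-integrable setT (EFin \o (\1_C : borel X -> R)).
  apply: (@integrable_bounded _ _ _ _ 1) => // y.
  by rewrite indicE ger0_norm ?ler0n// lern1 leq_b1.
split.
- by apply: measurable_funM => //; exact: measurable_cst.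
- apply: (@integrable_bounded _ _ _ _ `|c|).
    by apply: measurable_funM => //; exact: measurable_cst.
  move=> y; rewrite normrM ler_piMr// indicE ger0_norm ?ler0n//.
  by rewrite lern1 leq_b1.
- under eq_fun do rewrite orbit_meanZ.
  rewrite RintegralZl// Rintegral_indic_borel//.
  by apply: cvgM; [exact: cvg_cst|exact: clopen_cvg].
Qed.

Let goodD f g : good f -> good g -> good (fun y => f y + g y).
Proof.
move=> [mf intf cf] [mg ig cg]; split.
- exact: measurable_funD.
- exact: (integrableD measurableT intf ig).
- under eq_fun do rewrite orbit_meanD.
  by rewrite RintegralD//; apply: cvgD.
Qed.

Let good_saturated n (h : X -> R) : (forall y z, E n y z -> h y = h z) -> good h.
Proof.
move=> hE; have [s sX] := finite_cells rE cX n.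
suff G : forall D : set X, saturated E n D ->
    (forall y, D y -> exists2 z, z \in s & E n z y) ->
    good (fun y => h y * \1_D y).
  have := G setT; rewrite (_ : (fun y => _) = h); last first.
    by apply/funext => y; rewrite indicT mulr1.
  by apply.
elim: s {sX} => [|z s IH] D sD Ds.
  rewrite (_ : D = set0); last by rewrite -subset0 => y /Ds[].
  rewrite (_ : (fun y => _) = (fun y => 0 * \1_set0 y)).
    by apply: goodZ; exact: clopen0.
  by apply/funext => y; rewrite indic0 mul0r mulr0.
rewrite (_ : (fun y => _) = (fun y => h z * \1_(D `&` E n z) y +
    h y * \1_(D `&` ~` E n z) y)).
  apply: goodD.
    apply: goodZ; apply: (saturated_clopen rE (n := n)).
    by apply: saturatedI => //; exact: saturated_cell.
  apply: IH.
    by apply: saturatedI => //; apply: saturatedC => //; exact: saturated_cell.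
  move=> y [/Ds[w +] Ewy nEzy]; rewrite inE => /predU1P[wz|ws]; last by exists w.
  by exfalso; apply: nEzy; rewrite -wz.
apply/funext => y; rewrite !indicE.
have [Dy|nDy] := pselect (D y); last first.
  by rewrite !memNset ?mulr0 ?addr0// => -[].
have [Ezy|nEzy] := pselect (E n z y).
  rewrite (mem_set Dy) (mem_set (conj Dy Ezy : (D `&` E n z) y)) memNset.
    by rewrite mulr0 addr0 (hE _ _ Ezy).
  by move=> [].
rewrite (mem_set Dy) (mem_set (conj Dy nEzy : (D `&` ~` E n z) y)) memNset ?mulr0 ?add0r//.
by move=> [].
Qed.

(** Up to a uniformly small error a continuous function only depends on a
    finite clopen partition, hence is a linear combination of indicators of
    clopen sets; such functions are good by assumption. *)
Lemma quasi_generic_clopen : quasi_generic T x ell mu.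
Proof.
move=> f cf; rewrite -/(orbit_mean T x _ f).
apply/cvgrPdist_le => e e0; have e3 : 0 < e / 3 by rewrite divr_gt0.
have [n nf] : exists n, forall y z, E n y z -> `|f y - f z| <= e / 3.
  apply: (resolution_uniform rE cX) => y.
  have /cvgrPdist_le/(_ (e / 6)) := cf y.
  rewrite divr_gt0// => /(_ isT) /(res_base rE)[n sub].
  exists n => z w /sub/= fz /sub/= fw.
  rewrite (_ : f z - f w = (f y - f w) - (f y - f z)); last by ring.
  rewrite (le_trans (ler_normB _ _))//.
  by rewrite (_ : e / 3 = e / 6 + e / 6) ?lerD//; field.
(* equivalent points have the same class, hence the same chosen representative *)
pose h y := f (get (E n y)).
have Ehy y : E n y (get (E n y)) by apply: getI; exact: (res_refl rE n y).
have fh y : `|f y - h y| <= e / 3 by exact: nf.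
have [mh ih ch] : good h.
  apply: (@good_saturated n) => y z Eyz; rewrite /h; congr (f (get _)).
  apply/seteqP; split=> w; first exact: res_trans rE _ _ _ _ (res_sym rE Eyz).
  exact: res_trans rE _ _ _ _ Eyz.
have mf := borel_continuous cf.
have [c hc] : exists c, forall y, `|f y| <= c.
  have [N /= [_ Nb]] := compact_bounded (continuous_compact (A := setT)
    (f := f) (continuous_subspaceT cf) cX).
  exists (N + 1) => y; apply: Nb; first by rewrite ltrDl.
  by exists y.
have intf := integrable_bounded mu mf hc.
have ifh : mu.-integrable setT (EFin \o (fun y : borel X => f y - h y)).
  apply: (@integrable_bounded _ _ _ _ (e / 3)) => //.
  exact: measurable_funB.
have dI : `|\int[mu]_y f y - \int[mu]_y h y| <= e / 3.
  rewrite -RintegralB//; apply: (le_trans (le_normr_Rintegral _ _)) => //.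
  apply: (@le_trans _ _ (\int[mu]_y (cst (e / 3) (y : borel X)))).
    apply: le_Rintegral => //.
    - exact: (integrable_norm ifh).
    - apply: (@integrable_bounded _ _ _ (cst (e / 3)) (e / 3)) => [|y].
        exact: measurable_cst.
      by rewrite /= ger0_norm// ltW.
  have mu1 : fine (mu [set: borel X]) = 1 by rewrite probability_setT.
  by rewrite Rintegral_cst// -[leRHS]mulr1 ler_pM2l// -mu1.
move/cvgrPdist_le : ch => /(_ _ e3); apply: filterS => i.
move=> hi; have fi := orbit_mean_dist T x (ell i) fh.
rewrite -(subrKA (\int[mu]_y h y)) (le_trans (ler_normD _ _))//.
rewrite (_ : e = e / 3 + (e / 3 + e / 3)); last by field.
rewrite lerD// -(subrKA (orbit_mean T x (ell i) h)) (le_trans (ler_normD _ _))//.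
by rewrite lerD// distrC.
Qed.

End quasi_generic_clopen.

(** * The full shift and its products *)

Lemma resolution_continuous (X Y : topologicalType) (E : nat -> X -> set X)
    (F : nat -> Y -> set Y) (f : X -> Y) : resolution E -> resolution F ->
  (forall n x, exists m, forall y, E m x y -> F n (f x) (f y)) ->
  continuous f.
Proof.
move=> rE rF fEF x U /(res_base rF)[n sub]; have [m fm] := fEF n x.
by apply: filterS (res_nbhs rE m x) => y Exy; exact/sub/fm.
Qed.

Definition window_eq (n : nat) (x : binseq) : set binseq :=
  [set y | forall i : int, (`|i| <= n)%N -> x i = y i].

Lemma window_eq_nbhs n x : nbhs x (window_eq n x).
Proof.
have coord i : nbhs x [set y : binseq | x i = y i].
  have := @proj_continuous int (fun _ => bool) i x [set b | x i = b].
  by apply; rewrite nbhs_principalE; exact/principal_filterP.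
elim: n => [|n IH].
  apply: filterS (coord 0) => y xy i; rewrite leqn0 absz_eq0 => /eqP ->.
  exact: xy.
apply: filterS (filterI IH (filterI (coord n.+1%:Z) (coord (- n.+1%:Z)))).
move=> y [xy [xyp xyn]] i; rewrite leq_eqVlt ltnS => /predU1P[|/xy//].
by case: i => m /= => [->//|[->]]; rewrite NegzE.
Qed.

Lemma resolution_window : resolution window_eq.
Proof.
split => //.
- by move=> n x y xy i /xy.
- by move=> n x y z xy yz i ni; rewrite xy// yz.
- by move=> n m x y nm xy i ni; apply/xy/(leq_trans ni).
- exact: window_eq_nbhs.
- move=> x U xU; pose F : set_system binseq := filter_from setT (window_eq ^~ x).
  have FF : Filter F.
    apply: filter_from_filter; first by exists 0%N.
    move=> i j _ _; exists (maxn i j) => // y xy; split=> k ki; apply: xy.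
      by rewrite leq_max ki.
    by rewrite leq_max ki orbT.
  have : F --> x.
    apply/cvg_sup => i; apply/cvg_image; first by apply/seteqP; split => // b _;
      exists (fun _ => b).
    move=> A /nbhs_singleton xA; exists [set y : binseq | A (y i)].
      exists `|i|%N => // y xy /=; by rewrite -xy.
    apply/seteqP; split=> [_ [y Ay <-//]|b Ab]; by exists (fun _ => b).
  by move=> /(_ U xU)[n _ sub]; exists n.
Qed.

Lemma binseq_compact : compact [set: binseq].
Proof.
have := @tychonoff int (fun _ => bool) (fun _ => setT) (fun _ => bool_compact).
by congr compact; apply/seteqP; split.
Qed.

Definition prod_eq (X Y : Type) (E : nat -> X -> set X) (F : nat -> Y -> set Y)
  (n : nat) (p : X * Y) : set (X * Y) :=
  [set q | E n p.1 q.1 /\ F n p.2 q.2].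

Lemma resolution_prod (X Y : topologicalType) (E : nat -> X -> set X)
    (F : nat -> Y -> set Y) :
  resolution E -> resolution F -> resolution (prod_eq E F).
Proof.
move=> rE rF; split.
- by move=> n [x y]; split; [exact: res_refl|exact: res_refl].
- by move=> n p q [/(res_sym rE) ? /(res_sym rF)].
- move=> n p q r [pq1 pq2] [qr1 qr2].
  by split; [exact: res_trans rE _ _ _ _ pq1 qr1|exact: res_trans rF _ _ _ _ pq2 qr2].
- by move=> n m p q nm [/(res_mono rE nm) ? /(res_mono rF nm)].
- move=> n [x y]; exists (E n x, F n y) => //=.
  by split; exact: res_nbhs.
- move=> [x y] U [[A B] /= [/(res_base rE)[n nA] /(res_base rF)[m mB]] sub].
  exists (maxn n m) => -[x' y'] [/= xx' yy']; apply: sub; split => /=.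
    by apply/nA/(res_mono rE _ xx'); exact: leq_maxl.
  by apply/mB/(res_mono rF _ yy'); exact: leq_maxr.
Qed.

Lemma prod_compact (X Y : ptopologicalType) :
  compact [set: X] -> compact [set: Y] -> compact [set: (X * Y)%type].
Proof. by move=> cX cY; rewrite -setXTT; exact: compact_setX. Qed.

Lemma zshift_continuous k : continuous (zshift k).
Proof.
apply: (resolution_continuous resolution_window resolution_window) => n x.
exists (n + `|k|)%N => y xy i ni; apply: xy.
lia.
Qed.

Lemma sigma_continuous : continuous sigma. Proof. exact: zshift_continuous. Qed.

Lemma prod_map_continuous (X Y : ptopologicalType) (S : X -> X) (T : Y -> Y) :
  continuous S -> continuous T -> continuous (prod_map S T).
Proof.
move=> cS cT [x y]; apply: cvg_pair => /=.
  by apply: (@cvg_comp _ _ _ fst S _ (nbhs x)); [exact: cvg_fst|exact: cS].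
by apply: (@cvg_comp _ _ _ snd T _ (nbhs y)); [exact: cvg_snd|exact: cT].
Qed.

Lemma mix_continuous : continuous mix.
Proof.
apply: (resolution_continuous (resolution_prod (resolution_prod
  resolution_window resolution_window) resolution_window) resolution_window).
move=> n p; exists n => q [[pq1 pq2] pq3] i ni.
by rewrite /mix pq1// pq2// pq3.
Qed.

(** * Sums of periodic functions *)

Section periodic_sums.
Context (R : realType).
Implicit Types (F : nat -> R) (q L m n k : nat).

Definition psum F L : R := \sum_(1 <= n < L.+1) F n.

Definition nperiodic q F := forall n, F (n + q)%N = F n.

Lemma nperiodic_mul q F k : nperiodic q F -> nperiodic (q * k) F.
Proof.
move=> pF n; elim: k => [|k IH]; first by rewrite muln0 addn0.
by rewrite mulnS addnCA addnC pF.
Qed.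

Lemma psumD F L m :
  psum F (L + m) = psum F L + \sum_(1 <= n < m.+1) F (n + L)%N.
Proof.
rewrite /psum (big_cat_nat (n := L.+1))//=; last by rewrite ltnS leq_addr.
congr (_ + _); rewrite -{1}add1n big_addn.
by have -> : ((L + m).+1 - L = m.+1)%N by lia.
Qed.

Lemma psum_period q F m : nperiodic q F -> psum F (q * m) = m%:R * psum F q.
Proof.
move=> pF; elim: m => [|m IH]; first by rewrite muln0 mul0r /psum big_geq.
rewrite mulnS addnC psumD IH -[in RHS]natr1 mulrDl mul1r; congr (_ + _).
by apply: eq_bigr => n _; exact: nperiodic_mul.
Qed.

Lemma psum_shift q F k : nperiodic q F ->
  \sum_(1 <= n < q.+1) F (n + k)%N = psum F q.
Proof.
move=> pF; elim: k => [|k <-].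
  by apply: eq_bigr => n _; rewrite addn0.
pose G n := F (n + k)%N; have := psumD G 1 q.
rewrite add1n {1 2}/psum big_nat_recr//= big_nat1 addrC.
have -> : G q.+1 = G 1%N by rewrite /G -add1n addnAC pF.
move=> /addrI ->; by apply: eq_bigr => n _; rewrite /G addnS addn1.
Qed.

Lemma psum_ge0 F L : (forall n, 0 <= F n) -> 0 <= psum F L.
Proof. by move=> F0; exact: sumr_ge0. Qed.

Lemma psum_le F L : (forall n, F n <= 1) -> psum F L <= L%:R.
Proof.
move=> F1; apply: (@le_trans _ _ (\sum_(1 <= n < L.+1) 1)); first exact: ler_sum.
by rewrite sumr_const_nat subSS subn0.
Qed.

(** The last, incomplete, period contributes an error between -q and q. *)
Lemma psum_period_dist q F L : (0 < q)%N -> nperiodic q F ->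
  (forall n, 0 <= F n <= 1) ->
  `|psum F L - L%:R * (psum F q / q%:R)| <= q%:R.
Proof.
move=> q0 pF F01; have qR : 0 < q%:R :> R by rewrite ltr0n.
have F0 n : 0 <= F n by case/andP: (F01 n).
have F1 n : F n <= 1 by case/andP: (F01 n).
rewrite {1 2}(divn_eq L q) mulnC psumD psum_period// natrD natrM.
set r := (L %% q)%N; set rest := \sum_(1 <= n < _) _.
have rest0 : 0 <= rest by exact: sumr_ge0.
have restr : rest <= r%:R by exact: (@psum_le (fun n => F (n + q * (L %/ q))%N)).
have rq : r%:R <= q%:R :> R by rewrite ler_nat ltnW// ltn_pmod.
have m0 : 0 <= psum F q / q%:R by rewrite divr_ge0 ?psum_ge0// ltW.
have m1 : psum F q / q%:R <= 1 by rewrite ler_pdivrMr// mul1r psum_le.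
rewrite (_ : _ - _ = rest - r%:R * (psum F q / q%:R)); last by field; rewrite gt_eqF.
have : 0 <= r%:R * (psum F q / q%:R) by rewrite mulr_ge0.
have : r%:R * (psum F q / q%:R) <= r%:R by rewrite ler_piMr.
by rewrite ler_norml => ? ?; apply/andP; split; lra.
Qed.

Lemma psum_period_cvg q F : (0 < q)%N -> nperiodic q F ->
  (forall n, 0 <= F n <= 1) ->
  psum F L / L%:R @[L --> \oo] --> psum F q / q%:R.
Proof.
move=> q0 pF F01; apply/cvgrPdist_le => e e0.
near=> L.
have L0 : (0 < L)%N by near: L; exists 1%N.
have LR : 0 < L%:R :> R by rewrite ltr0n.
have := psum_period_dist L q0 pF F01; rewrite distrC.
rewrite (_ : L%:R * _ - psum F L = L%:R * (psum F q / q%:R - psum F L / L%:R)).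
  rewrite normrM gtr0_norm// -ler_pdivlMl// => /le_trans; apply.
  rewrite ler_pdivrMl// -ler_pdivrMr//.
  near: L; exact: nbhs_infty_ger.
by field; rewrite !pnatr_eq0 -!lt0n q0 L0.
Unshelve. all: by end_near.
Qed.

Lemma big_nat_multiples a L (h : nat -> R) : (0 < a)%N ->
  \sum_(1 <= n < (a * L).+1 | (a %| n)%N) h n = psum (fun m => h (a * m)%N) L.
Proof.
move=> a0; elim: L => [|L IH]; first by rewrite muln0 /psum !big_geq.
rewrite mulnS addnC (big_cat_nat (n := (a * L).+1))//=; last by rewrite ltnS leq_addr.
rewrite IH /psum [RHS]big_nat_recr//=; congr (_ + _).
rewrite -[X in (_ + X).+1](prednK a0) addnS big_mkcond big_nat_recr/=; last first.
  by rewrite ltnS leq_addr.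
rewrite -addnS prednK// -mulnSr dvdn_mulr// big_nat big1 ?add0r//.
move=> n /andP[n1 n2]; case: ifP => // /dvdnP[k nk].
exfalso; move: n1 n2; rewrite {n}nk => n1 n2.
have : (L < k)%N by rewrite -(ltn_pmul2l a0) (mulnC a k).
have : (k < L.+1)%N by rewrite -(ltn_pmul2l a0) (mulnC a k) mulnS; lia.
lia.
Qed.

End periodic_sums.

(** * Random divisors and zeta weights *)

Section thinning_identity.
Context (R : realType) (f g : nat -> R).
Hypotheses (f1 : f 1%N = 1) (fM : forall m n, (0 < m)%N -> (0 < n)%N ->
  f (m * n)%N = f m * f n).
Hypotheses (g1 : g 1%N = 1) (gp : forall p k m, prime p -> (0 < m)%N ->
  coprime p m -> g (p ^ k.+1 * m)%N = (1 - f p) * g m).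

Definition divisor_sum (N n : nat) : R :=
  \sum_(1 <= a < N.+1 | (a %| n)%N) f a * g (n %/ a)%N.

Lemma divisor_sum_widen (P : pred nat) (h : nat -> R) N M n : (0 < n <= N)%N ->
  (N <= M)%N ->
  \sum_(1 <= a < M.+1 | (a %| n)%N && P a) h a =
  \sum_(1 <= a < N.+1 | (a %| n)%N && P a) h a.
Proof.
move=> /andP[n0 nN] NM; rewrite (big_cat_nat (n := N.+1))//=.
rewrite [X in _ + X]big_nat_cond [X in _ + X]big1 ?addr0// => a.
by case/andP=> /andP[Na _] /andP[/(dvdn_leq n0) an _]; exfalso; lia.
Qed.

(** The numbers f a * g (n %/ a) are the law of a random divisor a of n. They
    sum to 1 by induction: for a prime p dividing n, the divisors divisible by
    p contribute f p, by the case of n / p, and the others contribute 1 - f p,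
    by the case of the part of n prime to p. *)
Lemma divisor_sum1 N n : (0 < n <= N)%N -> divisor_sum N n = 1.
Proof.
elim/ltn_ind: n N => n IH N /andP[n0 nN].
have [n1|n1] := leqP n 1.
  have {n1} n1 : n = 1%N by lia.
  rewrite n1 /divisor_sum big_ltn_cond ?dvd1n ?divn1 ?f1 ?g1 ?mul1r; last lia.
  rewrite big_nat_cond big1 ?addr0// => a.
  by rewrite dvdn1 => /andP[/andP[a1 _] /eqP ae]; exfalso; lia.
have pp := pdiv_prime n1; set p := pdiv n in pp.
have p0 := prime_gt0 pp.
have fact_n := pfactor_coprime pp n0; case: fact_n => m cpm nE.
have v0 : (0 < logn p n)%N by rewrite logn_gt0 mem_primes pp n0 pdiv_dvd.
have [v vE] : exists v, logn p n = v.+1 by exists (logn p n).-1; rewrite prednK.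
rewrite vE in nE.
have m0 : (0 < m)%N by move: n0; rewrite nE muln_gt0 => /andP[].
pose n' := (m * p ^ v)%N; have nE' : n = (p * n')%N by rewrite nE expnS /n'; ring.
have n'0 : (0 < n')%N by rewrite /n' muln_gt0 m0 expn_gt0 p0.
have n'n : (n' < n)%N by rewrite nE' ltn_Pmull// prime_gt1.
have mn : (m < n)%N.
  by rewrite nE ltn_Pmulr// -(exp1n v.+1) ltn_exp2r// prime_gt1.
rewrite /divisor_sum (bigID (fun a => p %| a)%N)/=.
have -> : \sum_(1 <= a < N.+1 | (a %| n)%N && (p %| a)%N) f a * g (n %/ a)%N = f p.
  rewrite -(@divisor_sum_widen _ _ N (p * N)) ?n0 ?leq_pmull//.
  under eq_bigl do rewrite andbC.
  rewrite big_mkcondr big_nat_multiples// /psum.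
  rewrite (@eq_big_nat _ _ _ _ _ _ (fun b => f p *
    (if (b %| n')%N then f b * g (n' %/ b)%N else 0))).
    rewrite -mulr_sumr -big_mkcond -/(divisor_sum N n') IH ?mulr1//.
    by rewrite n'0 (leq_trans (ltnW n'n)).
  move=> b /andP[b0 _]; rewrite nE' dvdn_pmul2l// divnMl// fM//.
  by case: ifP; rewrite ?mulrA ?mulr0.
have -> : \sum_(1 <= a < N.+1 | (a %| n)%N && ~~ (p %| a)%N) f a * g (n %/ a)%N =
    (1 - f p) * divisor_sum N m.
  rewrite /divisor_sum mulr_sumr.
  have dvd_m a : ((a %| n) && ~~ (p %| a))%N = (a %| m)%N.
    rewrite -prime_coprime//; apply/andP/idP => [[an cpa]|am].
      by move: an; rewrite nE Gauss_dvdl// coprime_sym coprimeXl.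
    split; first by rewrite nE dvdn_mulr.
    exact: coprime_dvdr am cpm.
  rewrite (eq_bigl _ _ dvd_m); apply: eq_bigr => a am.
  have a0 := dvdn_gt0 m0 am.
  rewrite mulrCA; congr (_ * _).
  rewrite -(@gp p v)//; last 2 first.
  - by rewrite divn_gt0// dvdn_leq.
  - by apply: coprime_dvdr cpm; exact: dvdn_div.
  by rewrite nE mulnC muln_divA.
by rewrite IH ?mulr1 ?subrKC// m0 (leq_trans (ltnW mn)).
Qed.

(** As M is closed under multiples, n belongs to M as soon as its random
    divisor does. *)
Lemma divisor_sum_pred (M : pred nat) N n : (0 < n <= N)%N ->
  (forall a, 0 <= f a) -> (forall a, 0 <= g a) ->
  (forall a, (a %| n)%N -> M a -> M n) -> forall A, (A <= N)%N ->
  \sum_(1 <= a < A.+1 | (a %| n)%N && M a) f a * g (n %/ a)%N <= (M n)%:R.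
Proof.
move=> nN f0 g0 MM A AN; have fg0 a : 0 <= f a * g (n %/ a)%N by rewrite mulr_ge0.
case: (boolP (M n)) => Mn; last first.
  rewrite big_pred0// => a; apply/negbTE; apply: contra Mn => /andP[].
  exact: MM.
rewrite -(divisor_sum1 nN) /divisor_sum.
rewrite [leRHS](big_cat_nat (n := A.+1))//=.
rewrite big_mkcondr -[leLHS]addr0 lerD//; last exact: sumr_ge0.
by apply: ler_sum => a _; case: ifP.
Qed.

End thinning_identity.

Section smooth_thinning.
Context (R : realType) (A : nat) (r : R).
Hypotheses (r0 : 0 < r).

Definition inv_power (a : nat) : R := a%:R `^ (- r).

(** The power a^-r, cut off at the integers having a prime factor larger than
    A; the cut-off makes the companion function [unthinned] periodic. *)
Definition smooth_power (a : nat) : R :=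
  if [pred p | p <= A]%N.-nat a then inv_power a else 0.

(** The function g that the identity [divisor_sum1] associates with f =
    [smooth_power]. *)
Definition unthinned (n : nat) : R :=
  \prod_(p < A.+1 | prime p && (p %| n)%N) (1 - inv_power p).

Lemma inv_power_ge0 a : 0 <= inv_power a. Proof. exact: powR_ge0. Qed.

Lemma inv_power1 : inv_power 1 = 1. Proof. by rewrite /inv_power powR1. Qed.

Lemma inv_powerE a : (0 < a)%N -> inv_power a = expR (- r * ln a%:R).
Proof. by move=> a0; rewrite /inv_power /powR pnatr_eq0 gtn_eqF. Qed.

Lemma inv_power_le1 a : (0 < a)%N -> inv_power a <= 1.
Proof.
move=> a0; rewrite inv_powerE// -[leRHS]expR0 ler_expR mulNr oppr_le0 mulr_ge0 ?(ltW r0)//.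
by rewrite ln_ge0 ?ler1n.
Qed.

Lemma inv_powerM m n : inv_power (m * n) = inv_power m * inv_power n.
Proof. by rewrite /inv_power natrM powRM. Qed.

Lemma smooth_power1 : smooth_power 1 = 1.
Proof. by rewrite /smooth_power inv_power1. Qed.

Lemma smooth_powerM m n : (0 < m)%N -> (0 < n)%N ->
  smooth_power (m * n) = smooth_power m * smooth_power n.
Proof.
move=> m0 n0; rewrite /smooth_power pnatM inv_powerM.
by case: (_.-nat m); case: (_.-nat n); rewrite /= ?mul0r ?mulr0.
Qed.

Lemma smooth_power_ge0 a : 0 <= smooth_power a.
Proof. by rewrite /smooth_power; case: ifP => // _; exact: inv_power_ge0. Qed.

Lemma smooth_power_le a : smooth_power a <= inv_power a.
Proof. by rewrite /smooth_power; case: ifP => // _; exact: inv_power_ge0. Qed.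

Lemma smooth_powerE a : (0 < a <= A)%N -> smooth_power a = inv_power a.
Proof.
move=> /andP[a0 aA]; rewrite /smooth_power (_ : _.-nat a)//.
apply/pnatP => // p pp /(dvdn_leq a0) pa; exact: leq_trans pa aA.
Qed.

Lemma unthinned_factor p : prime p -> 0 <= 1 - inv_power p <= 1.
Proof.
by move=> /prime_gt0 p0; rewrite subr_ge0 inv_power_le1//= gerBl inv_power_ge0.
Qed.

Lemma unthinned_ge0 n : 0 <= unthinned n.
Proof. by apply: prodr_ge0 => p /andP[/unthinned_factor/andP[]]. Qed.

Lemma unthinned_le1 n : unthinned n <= 1.
Proof.
suff /andP[] : 0 <= unthinned n <= 1 by [].
apply: (big_ind (fun x => 0 <= x <= 1)) => [|x y|p /andP[/unthinned_factor//]].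
  by rewrite ler01 lexx.
by move=> /andP[x0 x1] /andP[y0 y1]; rewrite mulr_ge0// mulr_ile1.
Qed.

Lemma unthinned1 : unthinned 1 = 1.
Proof.
rewrite /unthinned big_pred0// => p; rewrite dvdn1; apply/negbTE/negP.
by case/andP=> pp /eqP p1; rewrite p1 in pp.
Qed.

Lemma unthinned_prime p k m : prime p -> (0 < m)%N -> coprime p m ->
  unthinned (p ^ k.+1 * m) = (1 - smooth_power p) * unthinned m.
Proof.
move=> pp m0 cpm; rewrite /unthinned /smooth_power pnatE//.
have dvdE q : prime q -> (q %| p ^ k.+1 * m)%N = (q == p) || (q %| m)%N.
  by move=> pq; rewrite Euclid_dvdM// Euclid_dvdX// andbT dvdn_prime2.
have npm : (p %| m)%N = false by apply/negbTE; rewrite -prime_coprime.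
case: ifP; rewrite inE => pA; last first.
  rewrite subr0 mul1r; apply: eq_bigl => q; case: (boolP (prime q)) => //= pq.
  rewrite dvdE//; case: eqP => //= qp; move: (ltn_ord q); rewrite qp ltnS.
  by rewrite pA.
have pA' : (p < A.+1)%N by [].
rewrite (bigD1 (Ordinal pA'))/=; last by rewrite dvdE// eqxx pp.
congr (_ * _); apply: eq_bigl => q.
case: (boolP (prime q)) => //= pq; rewrite dvdE// -val_eqE/=.
by case: eqP => [->|]; rewrite ?npm ?andbT.
Qed.

Lemma unthinned_periodic : nperiodic A`! unthinned.
Proof.
move=> n; apply: eq_bigl => p; case: (boolP (prime p)) => //= pp.
by rewrite dvdn_addl// dvdn_fact// prime_gt0//= -ltnS.
Qed.

End smooth_thinning.

Section zeta_weights.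
Context (R : realType) (r : R).
Hypotheses (r0 : 0 < r).

Definition zeta_weight (a : nat) : R := inv_power r a / a%:R.

Lemma zeta_weight_ge0 a : 0 <= zeta_weight a.
Proof. by rewrite divr_ge0 ?inv_power_ge0. Qed.

(** With x = 1 / (a + 1), this is (1 - x)^-r >= 1 + r x, a consequence of the
    convexity inequalities for the exponential and the logarithm. *)
Lemma inv_power_decr a : (0 < a)%N ->
  r * zeta_weight a.+1 <= inv_power r a - inv_power r a.+1.
Proof.
move=> a0; have aR : 0 < a%:R :> R by rewrite ltr0n.
have a1R : 0 < a.+1%:R :> R by rewrite ltr0n.
have lnE : (a.+1%:R)^-1 <= ln a.+1%:R - ln a%:R :> R.
  rewrite -ln_div ?posrE// -[leLHS]opprK lerNl -lnV ?posrE ?divr_gt0// invf_div.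
  rewrite (_ : a%:R / a.+1%:R = 1 + - a.+1%:R^-1 :> R).
    by rewrite le_ln1Dx// ltrN2 invf_lt1// ltr1n.
  by rewrite -natr1; field; rewrite natr1 gt_eqF.
rewrite !inv_powerE// lerBrDr.
rewrite (_ : - r * ln a%:R = - r * ln a.+1%:R + r * (ln a.+1%:R - ln a%:R)); last by ring.
rewrite expRD /zeta_weight inv_powerE//.
apply: (@le_trans _ _ (expR (- r * ln a.+1%:R) *
  (1 + r * (ln a.+1%:R - ln a%:R)))); last first.
  by rewrite ler_pM2l ?expR_gt0// expR_ge1Dx.
rewrite mulrCA -[X in _ + X]mulr1 -mulrDr ler_pM2l ?expR_gt0//.
by rewrite addrC lerD2l ler_pM2l.
Qed.

Lemma zeta_weight_decr a : (0 < a)%N -> zeta_weight a.+1 <= zeta_weight a.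
Proof.
move=> a0; rewrite /zeta_weight ler_pM ?inv_power_ge0 ?invr_ge0//.
  rewrite -subr_ge0 (le_trans _ (inv_power_decr a0))// mulr_ge0 ?(ltW r0)//.
  exact: zeta_weight_ge0.
by rewrite lef_pV2 ?posrE ?ltr0n// ler_nat.
Qed.

Lemma zeta_weight1 : zeta_weight 1 = 1.
Proof. by rewrite /zeta_weight inv_power1 divr1. Qed.

(** Comparison with the integral of x^(-1-r), in telescoping form. *)
Lemma zeta_tail A L : (0 < A)%N ->
  \sum_(A.+1 <= a < L.+1) zeta_weight a <= inv_power r A / r.
Proof.
move=> A0; have [LA|/ltnW AL] := leqP L A.
  by rewrite big_geq// divr_ge0 ?inv_power_ge0// ltW.
rewrite ler_pdivlMr// mulrC.
suff : r * \sum_(A.+1 <= a < L.+1) zeta_weight a <= inv_power r A - inv_power r L.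
  by move=> /le_trans; apply; rewrite gerBl inv_power_ge0.
rewrite -(subnKC AL); elim: (L - A)%N => [|k IH].
  by rewrite addn0 big_geq// mulr0 subrr.
rewrite addnS big_nat_recr/=; last by rewrite ltnS leq_addr.
have Ak : (0 < A + k)%N by rewrite addn_gt0 A0.
by have := inv_power_decr Ak; rewrite mulrDr; lra.
Qed.

Definition zeta_sum (M : pred nat) (A : nat) : R :=
  \sum_(1 <= a < A.+1 | M a) zeta_weight a.

(** Abel summation: since the weights decrease, a set containing at least a
    proportion theta of each interval [1, n] with n >= n0 carries a proportion
    theta of the weights, up to a loss that is bounded uniformly in r and A. *)
Lemma zeta_sum_abel (M : pred nat) (theta : R) (n0 : nat) :
  0 <= theta <= 1 ->
  (forall n, (n0 <= n)%N -> theta * n%:R <= psum (fun a => (M a)%:R) n) ->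
  forall A, theta * zeta_sum xpredT A - n0%:R <= zeta_sum M A.
Proof.
move=> /andP[t0 t1] hM; pose c n : R := psum (fun a => (M a)%:R) n - theta * n%:R.
have c_ge n : - n0%:R <= c n.
  rewrite /c; have [/hM nn0|nn0] := leqP n0 n.
    by apply: (@le_trans _ _ 0); rewrite ?oppr_le0// subr_ge0.
  have : 0 <= psum (fun a => (M a)%:R) n :> R by apply: psum_ge0 => ?.
  have : theta * n%:R <= n0%:R.
    by apply: (@le_trans _ _ n%:R); rewrite ?ler_piMl// ler_nat ltnW.
  by lra.
(* the boundary term c A * zeta_weight A is part of the induction *)
have main A : (0 < A)%N -> c A * zeta_weight A - n0%:R * (1 - zeta_weight A) <=
    zeta_sum M A - theta * zeta_sum xpredT A.
  elim: A => // -[_ _|A IH _].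
    rewrite /c /psum /zeta_sum (big_mkcond M) !big_nat1 zeta_weight1/=.
    by case: (M 1%N) => /=; lra.
  have {}IH := IH isT; set w := zeta_weight A.+1 in IH *.
  have ww : zeta_weight A.+2 <= w by exact: zeta_weight_decr.
  set w' := zeta_weight A.+2 in ww *.
  have cS : c A.+2 = c A.+1 + (M A.+2)%:R - theta.
    rewrite /c {1}/psum big_nat_recr//= -/(psum _ _) -(natr1 A.+1).
    by ring.
  have zS (P : pred nat) : zeta_sum P A.+2 = zeta_sum P A.+1 + (P A.+2)%:R * w'.
    rewrite /zeta_sum !(big_mkcond P) big_nat_recr//=.
    by case: (P A.+2); rewrite ?mul1r ?mul0r.
  rewrite !zS cS /=; have := c_ge A.+1; move: IH.
  move: (c A.+1) (zeta_sum M _) (zeta_sum xpredT _) (M _)%:R => cA z1 z2 m IH cn.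
  have : 0 <= (cA + n0%:R) * (w - w') by rewrite mulr_ge0//; lra.
  by move: IH; lra.
case=> [|A]; first by rewrite /zeta_sum !big_geq// mulr0 sub0r oppr_le0.
have := main A.+1 isT; have := c_ge A.+1.
have : 0 <= zeta_weight A.+1 by exact: zeta_weight_ge0.
move: (c A.+1) (zeta_weight A.+1) (zeta_sum M _) (zeta_sum xpredT _) => cA w z1 z2 w0 cn.
have : 0 <= (cA + n0%:R) * w by rewrite mulr_ge0//; lra.
by lra.
Qed.

(** The random divisor of a uniform integer of [1, (A!)^2] follows the zeta
    law on [1, A] up to the tail of the zeta sum. Since M contains an integer
    whenever it contains its random divisor, the frequency of M is at least
    its weight under the zeta law. The length (A!)^2 contains a whole number
    of periods of g (n / a) for every a <= A. *)
Lemma zeta_sum_density (A : nat) (M : pred nat) : (0 < A)%N ->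
  (forall a n, (0 < n)%N -> (a %| n)%N -> M a -> M n) ->
  zeta_sum M A * (1 - inv_power r A / r) <=
  zeta_sum xpredT A * (psum (fun n => (M n)%:R) (A`! * A`!) / (A`! * A`!)%:R).
Proof.
move=> A0 hM; set L := (A`! * A`!)%N.
have AF : (0 < A`!)%N by exact: fact_gt0.
have L0 : (0 < L)%N by rewrite muln_gt0 AF.
have LR : 0 < L%:R :> R by rewrite ltr0n.
have AL : (A <= L)%N.
  by apply: (@leq_trans A`!); [exact: fact_geq|rewrite leq_pmulr].
pose f := smooth_power A r; pose g := unthinned A r.
have f0 a : 0 <= f a by exact: smooth_power_ge0.
have g0 a : 0 <= g a by exact: unthinned_ge0.
have fE a : (0 < a <= A)%N -> f a = inv_power r a by exact: smooth_powerE.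
have T1 : forall N n, (0 < n <= N)%N -> divisor_sum f g N n = 1.
  apply: divisor_sum1; [exact: smooth_power1|exact: smooth_powerM|
    exact: unthinned1|exact: unthinned_prime].
pose Gam := psum g A`!.
have gsum a : (0 < a <= A)%N ->
    \sum_(1 <= n < L.+1 | (a %| n)%N) f a * g (n %/ a)%N =
    A`!%:R * Gam * zeta_weight a.
  move=> /[dup] aA /andP[a0 aA']; rewrite -mulr_sumr fE//.
  have adv : (a %| A`!)%N by rewrite dvdn_fact// a0.
  have LE : L = (a * (A`! * (A`! %/ a)))%N.
    by rewrite mulnCA mulnA -mulnA (mulnC a) divnK.
  rewrite LE big_nat_multiples//.
  rewrite (_ : psum _ _ = psum g (A`! * (A`! %/ a))); last first.
    by apply: eq_bigr => n _; rewrite mulKn.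
  rewrite psum_period; last exact: unthinned_periodic.
  rewrite natf_div// /zeta_weight -/Gam; field.
  by rewrite pnatr_eq0 -lt0n.
have swap (P : pred nat) K : \sum_(1 <= n < L.+1)
    \sum_(1 <= a < K.+1 | (a %| n)%N && P a) f a * g (n %/ a)%N =
    \sum_(1 <= a < K.+1 | P a) \sum_(1 <= n < L.+1 | (a %| n)%N) f a * g (n %/ a)%N.
  under eq_bigr do rewrite big_andbC big_mkcondr.
  rewrite exchange_big/=; apply: eq_bigr => a _.
  by rewrite -big_mkcond.
have count_ge : A`!%:R * Gam * zeta_sum M A <= psum (fun n => (M n)%:R) L.
  rewrite /zeta_sum mulr_sumr.
  rewrite (_ : \sum_(_ <= _ < _ | _) _ = \sum_(1 <= n < L.+1)
    \sum_(1 <= a < A.+1 | (a %| n)%N && M a) f a * g (n %/ a)%N).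
    apply: ler_sum_nat => n /andP[n0 nL].
    have nL' : (0 < n <= L)%N by rewrite n0.
    apply: (divisor_sum_pred _ _ _ _ nL') => //; [exact: smooth_power1|
      exact: smooth_powerM|exact: unthinned1|exact: unthinned_prime|].
    by move=> a; exact: hM.
  rewrite swap big_nat_cond [RHS]big_nat_cond; apply: eq_bigr => a.
  by move=> /andP[aA _]; rewrite gsum.
have total : L%:R * (1 - inv_power r A / r) <= A`!%:R * Gam * zeta_sum xpredT A.
  have -> : L%:R * (1 - inv_power r A / r) = L%:R - L%:R * (inv_power r A / r).
    by ring.
  have LE : L%:R = \sum_(1 <= n < L.+1) divisor_sum f g L n :> R.
    under eq_big_nat => n nL do rewrite T1//.
    by rewrite sumr_const_nat subSS subn0.
  rewrite lerBlDr {1}LE /divisor_sum.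
  under eq_bigr do under eq_bigl do rewrite -[(_ %| _)%N]andbT.
  rewrite (swap xpredT L) (big_cat_nat (n := A.+1))//=.
  rewrite lerD//.
    rewrite /zeta_sum mulr_sumr; apply: ler_sum_nat => a aA.
    by rewrite gsum.
  apply: (@le_trans _ _ (\sum_(A.+1 <= a < L.+1) L%:R * zeta_weight a)).
    apply: ler_sum_nat => a /andP[Aa aL].
    have a0 : (0 < a)%N by exact: leq_ltn_trans Aa.
    have aR : 0 < a%:R :> R by rewrite ltr0n.
    apply: (@le_trans _ _ (\sum_(1 <= n < L.+1 | (a %| n)%N) inv_power r a)).
      apply: ler_sum => n _; rewrite -[leRHS]mulr1 ler_pM//.
        exact: smooth_power_le.
      exact: unthinned_le1.
    have aLL : (a * (L %/ a) <= L)%N by rewrite mulnC leq_divM.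
    rewrite (big_cat_nat (n := (a * (L %/ a)).+1))//=.
    rewrite big_nat_multiples// [X in _ + X]big_nat_cond [X in _ + X]big_pred0.
      rewrite addr0 /psum sumr_const_nat subSS subn0 -[leLHS]mulr_natl /zeta_weight.
      rewrite [leLHS]mulrC [leRHS]mulrCA ler_wpM2l ?inv_power_ge0//.
      by rewrite ler_pdivlMr// -natrM ler_nat leq_divM.
    move=> n; apply/negbTE/negP => /andP[/andP[n1 n2] /dvdnP[k nk]].
    have : (L %/ a < k)%N by rewrite -(ltn_pmul2l a0) (mulnC a k) -nk.
    rewrite ltn_divLR// -nk => Ln; lia.
  rewrite -mulr_sumr ler_wpM2l// ?(ltW LR)//; exact: zeta_tail.
rewrite mulrA ler_pdivlMr//.
have Z0 P : 0 <= zeta_sum P A by apply: sumr_ge0 => a _; exact: zeta_weight_ge0.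
apply: (@le_trans _ _ (zeta_sum M A * (A`!%:R * Gam * zeta_sum xpredT A))).
  by rewrite -[leLHS]mulrA ler_wpM2l// mulrC.
rewrite (_ : zeta_sum M A * _ = zeta_sum xpredT A * (A`!%:R * Gam * zeta_sum M A)).
  by rewrite ler_wpM2l.
by ring.
Qed.

End zeta_weights.

(** * The Davenport-Erdos theorem *)

Section lower_limits.
Context (R : realType) (u : nat -> R).
Hypothesis u01 : forall n, 0 <= u n <= 1.

Let bounded_u : bounded_fun (u : nat -> R^o).
Proof.
exists 1; split; first exact: num_real.
move=> M M1 n _; case/andP: (u01 n) => u0 u1.
by rewrite /= ger0_norm// (le_trans u1)// ltW.
Qed.

Let infs_le n m : (n <= m)%N -> infs u n <= u m.
Proof.
move=> nm; apply: ge_inf; last by exists m.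
by exists 0 => _ [k _ <-]; case/andP: (u01 k).
Qed.

Let infs_ub : has_ubound (range (infs u)).
Proof.
exists 1 => _ [n _ <-]; apply: le_trans (infs_le (leqnn n)) _.
by case/andP: (u01 n).
Qed.

Lemma limn_inf_eventually_ge x : x < limn_inf u -> \forall n \near \oo, x <= u n.
Proof.
rewrite limn_infE// => xs.
have [||_ [n _ <-]] := @sup_adherent R (range (infs u)) (sup (range (infs u)) - x).
- by rewrite subr_gt0.
- by split => //; exists (infs u 0); exists 0%N.
rewrite subKr => xn; exists n => // m /= nm.
exact: le_trans (ltW xn) (infs_le nm).
Qed.

Lemma limn_inf_infinitely_often x n : limn_inf u < x ->
  exists2 m, (n <= m)%N & u m < x.
Proof.
rewrite limn_infE// => sx.
have iu : infs u n < x.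
  by apply: le_lt_trans sx; apply: ub_le_sup => //; exists n.
have [||_ [m nm <-] mx] := @inf_adherent R (sdrop u n) (x - infs u n).
- by rewrite subr_gt0.
- split; first by exists (u n); exists n => /=.
  by exists 0 => _ [k _ <-]; case/andP: (u01 k).
by exists m => //; move: mx; rewrite subrKC.
Qed.

Lemma limn_inf_subsequence : exists ell : nat -> nat,
  [/\ forall i, (0 < ell i)%N, ell i @[i --> \oo] --> \oo &
      u (ell i) @[i --> \oo] --> limn_inf u].
Proof.
have ex i : exists m, (i < m)%N /\ u m < limn_inf u + i.+1%:R^-1.
  have [|m im um] := @limn_inf_infinitely_often (limn_inf u + i.+1%:R^-1) i.+1.
    by rewrite ltrDl invr_gt0.
  by exists m.
have [ell ellP] := choice ex.
have ellI : ell i @[i --> \oo] --> \oo.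
  apply/cvgnyPge => A; exists A => // i /= Ai.
  by apply: leq_trans Ai _; have [/ltnW] := ellP i.
exists ell; split => //; first by move=> i; have [im _] := ellP i; exact: leq_ltn_trans im.
apply/cvgrPdist_le => e e0; near=> i.
rewrite ler_norml; apply/andP; split.
  have [_ ui] := ellP i.
  rewrite lerNl opprB lerBlDl (le_trans (ltW ui))// lerD2l.
  rewrite -[leRHS]invrK lef_pV2 ?posrE ?invr_gt0//.
  apply: (@le_trans _ _ i%:R); last by rewrite ler_nat.
  by near: i; exact: nbhs_infty_ger.
rewrite lerBlDl -lerBlDr.
near: i.
have /limn_inf_eventually_ge : limn_inf u - e < limn_inf u by rewrite ltrBlDr ltrDl.
by move=> h; exact: (ellI _ h).
Unshelve. all: by end_near.
Qed.

End lower_limits.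

Section davenport_erdos.
Context (R : realType).

Definition below (B : set nat) (K : nat) : set nat := [set b | B b /\ (b <= K)%N].

Definition indz (A : set int) (n : nat) : R := (n%:Z \in A)%:R.

Lemma indz01 A n : 0 <= indz A n <= 1.
Proof. by rewrite /indz ler0n lern1 leq_b1. Qed.

Lemma freqE A L : freq R A L = psum (indz A) L / L%:R.
Proof. by rewrite /freq natr_sum. Qed.

Lemma freq01 A L : 0 <= freq R A L <= 1.
Proof.
rewrite freqE; apply/andP; split.
  by rewrite divr_ge0 ?psum_ge0// => n; case/andP: (indz01 A n).
have [->|L0] := posnP L; first by rewrite invr0 mulr0.
by rewrite ler_pdivrMr ?ltr0n// mul1r psum_le// => n; case/andP: (indz01 A n).
Qed.

Lemma harmonic_unbounded (H : R) : exists A, H <= psum (fun a => a%:R^-1) A.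
Proof.
apply: contrapT => /forallNP nH; apply: (@dvg_harmonic R).
have serE n : series harmonic n = psum (fun a => a%:R^-1) n :> R.
  by rewrite /psum big_add1/=; apply: eq_bigr.
apply: nondecreasing_is_cvgn.
  move=> n m nm; rewrite !serE /psum (big_cat_nat (n := n.+1) (p := m.+1))//=.
  by rewrite lerDl; apply: sumr_ge0.
exists H => _ [n _ <-]; rewrite serE ltW// ltNge; exact/negP.
Qed.

(** When r tends to 0 the weights of the first A integers tend to 1 / a, and
    the harmonic series diverges. *)
Lemma zeta_sum_unbounded (H : R) : exists2 r : R, 0 < r &
  exists A0, forall A, (A0 <= A)%N -> H <= zeta_sum r xpredT A.
Proof.
have [A HA] := harmonic_unbounded (H * 2).
pose r : R := (2 * (1 + ln A.+1%:R))^-1.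
have l0 : 0 <= ln A.+1%:R :> R by rewrite ln_ge0// ler1n.
have r0 : 0 < r by rewrite invr_gt0 mulr_gt0// ltr_pwDl.
exists r => //; exists A => A' AA'.
apply: (@le_trans _ _ (zeta_sum r xpredT A)); last first.
  rewrite /zeta_sum (big_cat_nat (n := A.+1) (p := A'.+1))//= lerDl.
  by apply: sumr_ge0 => a _; exact: zeta_weight_ge0.
rewrite -(ler_pM2r (ltr0n R 2)) (le_trans HA)// /psum /zeta_sum mulr_suml.
apply: ler_sum_nat => a /andP[a0 aA].
have aR : 0 < a%:R :> R by rewrite ltr0n.
rewrite /zeta_weight mulrAC -[leLHS]mul1r ler_wpM2r ?invr_ge0//.
rewrite -ler_pdivrMr// mul1r inv_powerE//.
apply: (@le_trans _ _ (1 + (- r * ln a%:R))); last exact: expR_ge1Dx.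
have : r * ln a%:R <= 2^-1.
  apply: (@le_trans _ _ (r * (1 + ln A.+1%:R))).
    rewrite ler_pM2l//; apply: (@le_trans _ _ (ln A.+1%:R)); last by rewrite lerDr.
    by rewrite ler_ln ?posrE ?ltr0n// ler_nat ltnW.
  by rewrite /r invfM mulfVK// gt_eqF// ltr_pwDl.
by rewrite mulNr; lra.
Qed.

Lemma inv_power_small (r e : R) : 0 < r -> 0 < e ->
  \forall A \near \oo, inv_power r A <= e.
Proof.
move=> r0 e0; near=> A.
have A0 : (0 < A)%N by near: A; exists 1%N.
rewrite inv_powerE// -[leRHS]lnK ?posrE// ler_expR mulNr lerNl -ler_pdivrMl//.
rewrite -[leLHS]expRK ler_ln ?posrE ?expR_gt0 ?ltr0n//.
by near: A; exact: nbhs_infty_ger.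
Unshelve. all: by end_near.
Qed.

Lemma multiples_dvd (B : set nat) (a n : nat) : (a %| n)%N ->
  a%:Z \in multiples B -> n%:Z \in multiples B.
Proof.
move=> an; rewrite !inE => -[b Bb ba]; exists b => //.
by rewrite (dvdz_trans ba)// /dvdz/=.
Qed.

(** Suppose that all finite parts of B have multiples of density less than ld
    - e, where ld is the lower density of all the multiples. By
    [zeta_sum_density] the weight of these multiples under the zeta law is
    less than about ld - e. On [1, A] the multiples of B and of its elements
    up to A coincide, and Abel summation gives them a weight of at least about
    ld - e / 2, because the total mass of the zeta weights is unbounded as r
    tends to 0. As A! is a period of the multiples of [below B A], their
    frequency over the length (A!)^2 is their density. *)
Theorem davenport_erdos (B : set nat) (e : R) : 0 < e ->
  exists K, lower_density R (multiples B) <=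
    freq R (multiples (below B K)) (K`! * K`!) + e.
Proof.
move=> e0; apply: contrapT => /forallNP nK.
pose ld : R := lower_density R (multiples B).
have {}nK K : freq R (multiples (below B K)) (K`! * K`!) + e < ld.
  by rewrite ltNge; exact/negP.
pose theta : R := ld - e / 2.
have [n0 _ hn0] : \forall n \near \oo, theta <= freq R (multiples B) n.
  apply: limn_inf_eventually_ge => [n|]; first exact: freq01.
  by rewrite /theta -/(lower_density R _) -/ld ltrBlDr ltrDl divr_gt0.
have theta01 : 0 <= theta <= 1.
  apply/andP; split.
    have := nK 0%N; have /andP[] := freq01 (multiples (below B 0)) (0`! * 0`!).
    by rewrite /theta; lra.
  apply: le_trans (hn0 n0 _) _ => //=.
  by case/andP: (freq01 (multiples B) n0).
have hM n : (n0 <= n)%N ->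
    theta * n%:R <= psum (fun a => (a%:Z \in multiples B)%:R) n.
  have [->|n1] := posnP n.
    by rewrite mulr0 => _; apply: psum_ge0.
  by move=> /hn0 /=; rewrite freqE ler_pdivlMr// ltr0n.
(* this bound makes the loss n0 in the Abel summation less than e / 4 times the
   total weight *)
have [r r0 [A0 hA0]] := zeta_sum_unbounded (4 * n0%:R / e + 1).
have [A [AA0 A1 tailA]] : exists A, [/\ (A0 <= A)%N, (0 < A)%N &
    inv_power r A / r <= e / 8].
  have [A1 _ hA1] := @inv_power_small r (e / 8 * r) r0 (mulr_gt0 (divr_gt0 e0 (ltr0n R 8)) r0).
  exists (maxn A0 A1).+1; split => //.
    by rewrite ltnW// ltnS leq_maxl.
  by rewrite ler_pdivrMr//; apply: hA1 => /=; rewrite ltnW// ltnS leq_maxr.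
have := hA0 A AA0.
have := zeta_sum_abel r0 (M := fun a => a%:Z \in multiples B) theta01 hM A.
have := zeta_sum_density r0 (M := fun a => a%:Z \in multiples (below B A)) A1
  (fun a n _ => @multiples_dvd _ a n).
rewrite (_ : zeta_sum r _ A = zeta_sum r (fun a => a%:Z \in multiples B) A); last first.
  rewrite /zeta_sum big_nat_cond [RHS]big_nat_cond; apply: eq_bigl => a.
  case: (boolP (1 <= a < A.+1)%N) => //= /andP[a1 aA]; apply/idP/idP; rewrite !inE.
    by move=> [b [Bb _] ba]; exists b.
  move=> [b Bb ba]; exists b => //; split => //.
  by rewrite -ltnS (leq_ltn_trans _ aA)// dvdn_leq.
rewrite -[X in _ <= _ * X]freqE; have := nK A.
have : 0 <= inv_power r A / r by rewrite divr_ge0 ?inv_power_ge0// ltW.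
have n00 : 0 <= n0%:R :> R by [].
have /andP[d0 _] := freq01 (multiples (below B A)) (A`! * A`!).
case/andP: theta01; move: tailA.
move: (inv_power r A / r) (zeta_sum r xpredT A) (zeta_sum _ _ A) => t Z W.
move: (freq _ _ _) d0 => d d0 te th0 th1 t0 dld WZ zW HZ.
have Z0 : 0 < Z by rewrite (lt_le_trans _ HZ)// ltr_pwDr// divr_ge0 ?mulr_ge0// ltW.
have eZ : 4 * n0%:R < e * Z.
  rewrite [ltRHS]mulrC -ltr_pdivrMr//; apply: lt_le_trans HZ; by rewrite ltrDl.
have dZ : Z * d <= Z * (theta - e / 2).
  by rewrite ler_pM2l// /theta; lra.
have tZ : Z * t * theta <= Z * (e / 8).
  rewrite -mulrA ler_pM2l// -[leRHS]mulr1 ler_pM//.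
have : (theta * Z - n0%:R) * (1 - t) <= W * (1 - t).
  have [t1|t1] := leP t 1; first by rewrite ler_wpM2r// subr_ge0.
  (* t > 1 gives e > 8, but d + e < ld <= 1 + e / 2 gives e < 2 *)
  exfalso.
  have : ld <= 1 + e / 2 by rewrite -lerBlDr.
  by lra.
have : 0 <= t * n0%:R by rewrite mulr_ge0.
by lra.
Qed.

End davenport_erdos.

(** * Frequencies of sets of integers and of sets of multiples *)

Section frequencies.
Context (R : realType).
Implicit Types (A C : set int) (L : nat) (e : R).

Lemma freq_le A C L : A `<=` C -> freq R A L <= freq R C L.
Proof.
move=> AC; rewrite !freqE ler_wpM2r ?invr_ge0//; apply: ler_sum => n _.
by rewrite /indz ler_nat; case: (boolP (_ \in A)); rewrite ?inE// => /AC /mem_set ->.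
Qed.

Lemma freq_setU A C L : freq R (A `|` C) L <= freq R A L + freq R C L.
Proof.
rewrite !freqE -mulrDl ler_wpM2r ?invr_ge0// -big_split; apply: ler_sum => n _.
rewrite /indz in_setU /=.
by case: (_ \in A); case: (_ \in C); rewrite /= -?natrD ler_nat.
Qed.

Lemma freq_setD A C L : C `<=` A ->
  freq R (A `\` C) L = freq R A L - freq R C L.
Proof.
move=> CA; rewrite !freqE -mulrBl -sumrB; congr (_ / _); apply: eq_bigr => n _.
rewrite /indz in_setD; have [/set_mem/CA/mem_set ->|_] := boolP (_ \in C).
  by rewrite subrr.
by rewrite andbT subr0.
Qed.

Lemma freq_lt_exists A C L : freq R C L < freq R A L ->
  exists m : int, A m /\ ~ C m.
Proof.
move=> CA; apply: contrapT => /forallNP nAC; move: CA; rewrite ltNge => /negP; apply.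
by apply: freq_le => m Am; apply: contrapT => nCm; apply: (nAC m).
Qed.

Definition translate_set (k : int) A : set int := [set n | A (n + k)].

(** Only the ends of the interval [1, L] are affected by the translation. *)
Lemma freq_translate k A L :
  freq R (translate_set k A) L <= freq R A L + `|k|%N%:R / L%:R.
Proof.
rewrite !freqE -mulrDl ler_wpM2r ?invr_ge0//.
set F := indz R A; set G := indz R (translate_set k A).
have F0 n : 0 <= F n by case/andP: (indz01 R A n).
have F1 n : F n <= 1 by case/andP: (indz01 R A n).
have G0 n : 0 <= G n by case/andP: (indz01 R (translate_set k A) n).
have G1 n : G n <= 1 by case/andP: (indz01 R (translate_set k A) n).
have FG n : (k + n%:Z \in A)%:R = G n by rewrite /G /indz addrC; congr (_%:R); apply/idP/idP; rewrite !inE.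
case: (intP k) FG => [|j|j] FG.
- rewrite addr0 /psum; apply: ler_sum => n _.
  by rewrite -FG add0r.
- have -> : psum G L = \sum_(1 <= n < L.+1) F (n + j.+1)%N.
    by apply: eq_bigr => n _; rewrite -FG /F /indz PoszD addrC.
  have := psumD F j.+1 L; rewrite addnC psumD absz_nat.
  have : 0 <= psum F j.+1 by exact: psum_ge0.
  have : \sum_(1 <= n < j.+2) F (n + L)%N <= j.+1%:R.
    exact: (@psum_le _ (fun n => F (n + L)%N)).
  move: (\sum_(1 <= n < L.+1) _) (\sum_(1 <= n < j.+2) _) (psum F L) (psum F j.+1).
  by move=> x y z t; lra.
- have := psumD G j.+1 L.
  have -> : \sum_(1 <= n < L.+1) G (n + j.+1)%N = psum F L.
    apply: eq_bigr => n _; rewrite -FG /F /indz PoszD.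
    by rewrite addrCA addNr addr0.
  rewrite addnC psumD (_ : `|- _|%N = j.+1)//.
  have : 0 <= \sum_(1 <= n < j.+2) G (n + L)%N by exact: sumr_ge0.
  have : psum G j.+1 <= j.+1%:R by exact: psum_le.
  move: (\sum_(1 <= n < j.+2) _) (psum F L) (psum G j.+1) (psum G L).
  by move=> x y z t; lra.
Qed.

Definition thicken (n : nat) A : set int :=
  [set k | exists2 i : int, (`|i| <= n)%N & A (k + i)].

Lemma thickenS n A : thicken n.+1 A = thicken n A `|`
  (translate_set n.+1%:Z A `|` translate_set (- n.+1%:Z) A).
Proof.
apply/seteqP; split=> [k [i]|k [[i ni Ai]|[Ai|Ai]]].
- rewrite leq_eqVlt ltnS => /predU1P[ni Ai|ni Ai]; last by left; exists i.
  by right; case: i ni Ai => m /= [<-] Ai; [left|right; rewrite -NegzE].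
- by exists i => //; rewrite ltnW.
- by exists n.+1%:Z.
- by exists (- n.+1%:Z) => //; rewrite abszN.
Qed.

(** Thickening multiplies asymptotic frequencies by at most 2 n + 1. *)
Lemma freq_thicken n e : 0 < e -> exists2 d : R, 0 < d &
  forall (ell : nat -> nat) A, ell i @[i --> \oo] --> \oo ->
    (\forall i \near \oo, freq R A (ell i) <= d) ->
    \forall i \near \oo, freq R (thicken n A) (ell i) <= e.
Proof.
elim: n e => [|n IH] e e0.
  exists e => // ell A _; apply: filterS => i; apply: le_trans.
  apply: freq_le => k [j]; rewrite leqn0 absz_eq0 => /eqP ->.
  by rewrite addr0.
have [d d0 dP] := IH (e / 3) (divr_gt0 e0 (ltr0n R 3)).
exists (Num.min d (e / 6)) => [|ell A ellI A_small].
  by rewrite lt_min d0 divr_gt0.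
have [Ad Ae] : (\forall i \near \oo, freq R A (ell i) <= d) /\
    (\forall i \near \oo, freq R A (ell i) <= e / 6).
  by split; apply: filterS A_small => i; rewrite le_min => /andP[].
have thick_small := dP ell A ellI Ad.
have big_ell : \forall i \near \oo, 6 * n.+1%:R / e <= (ell i)%:R.
  exact: (ellI _ (nbhs_infty_ger (6 * n.+1%:R / e))).
near=> i; have h1 : freq R (thicken n A) (ell i) <= e / 3 by near: i.
have h2 : freq R A (ell i) <= e / 6 by near: i.
have h3 : n.+1%:R / (ell i)%:R <= e / 6.
  have : 6 * n.+1%:R / e <= (ell i)%:R by near: i.
  have pos : 0 < 6 * n.+1%:R / e by rewrite divr_gt0// mulr_gt0// ltr0n.
  move=> /[dup] /(lt_le_trans pos) L0.
  rewrite ler_pdivrMr// ler_pdivrMr// => h.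
  by lra.
rewrite thickenS (le_trans (freq_setU _ _ _))//.
have := freq_setU (translate_set n.+1%:Z A) (translate_set (- n.+1%:Z) A) (ell i).
have := freq_translate n.+1%:Z A (ell i).
have := freq_translate (- n.+1%:Z) A (ell i).
rewrite abszN /=.
by move: (n.+1%:R / (ell i)%:R) h3 => t; lra.
Unshelve. all: by end_near.
Qed.

End frequencies.

Section multiples_tails.
Context (R : realType).
Implicit Types (B : set nat) (A : set int).

Lemma below_sub B K : below B K `<=` B. Proof. by move=> b []. Qed.

Lemma multiplesS B C : B `<=` C -> multiples B `<=` multiples C.
Proof. by move=> BC n [b Bb bn]; exists b => //; exact: BC. Qed.

Lemma belowS B K K' : (K <= K')%N -> below B K `<=` below B K'.
Proof. by move=> KK' b [Bb bK]; split => //; exact: leq_trans KK'. Qed.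

Definition zperiodic (q : nat) A := forall n, A (n + q%:Z) <-> A n.

Lemma zperiodic_indz q A : zperiodic q A -> nperiodic q (indz R A).
Proof.
move=> pA n; rewrite /indz PoszD.
suff -> : (n%:Z + q%:Z \in A) = (n%:Z \in A) by [].
by apply/idP/idP; rewrite !inE => /pA.
Qed.

Lemma below_zperiodic B K : B `<=` positives ->
  zperiodic K`! (multiples (below B K)).
Proof.
move=> hB n; have dv b : below B K b -> (b%:Z %| K`!%:Z)%Z.
  by move=> [Bb bK]; rewrite dvdzE !absz_nat dvdn_fact// bK andbT; exact: hB.
split=> -[b Bb bn]; exists b => //.
  by move: bn; rewrite rpredDr// dv.
by rewrite rpredD// dv.
Qed.

Lemma zperiodic_cvg q A (ell : nat -> nat) : (0 < q)%N -> zperiodic q A ->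
  ell i @[i --> \oo] --> \oo ->
  freq R A (ell i) @[i --> \oo] --> psum (indz R A) q / q%:R.
Proof.
move=> q0 pA ellI; under eq_fun do rewrite freqE.
have := psum_period_cvg q0 (zperiodic_indz pA) (indz01 R A).
exact: cvg_comp ellI.
Qed.

(** Along a sequence realizing the lower density both frequencies converge,
    and the theorem of Davenport and Erdos compares their limits. *)
Lemma multiples_tail B (e : R) : B `<=` positives -> 0 < e ->
  exists K0, forall K ell, (K0 <= K)%N ->
    realizes_lower_density R ell (multiples B) ->
    \forall i \near \oo,
      freq R (multiples B `\` multiples (below B K)) (ell i) <= e.
Proof.
move=> hB e0; have e3 : 0 < e / 3 by rewrite divr_gt0.
have [K0 DE] := davenport_erdos B e3.
exists K0 => K ell K0K [_ ellI ellB].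
have p := below_zperiodic K0 hB.
have := zperiodic_cvg (fact_gt0 K0) p ellI.
set d := psum _ _ / _ => belowI.
have dE : freq R (multiples (below B K0)) (K0`! * K0`!) = d.
  rewrite freqE psum_period; last exact: zperiodic_indz.
  rewrite /d natrM; field.
  by rewrite pnatr_eq0 -lt0n fact_gt0.
rewrite dE in DE.
move/cvgrPdist_le : ellB => /(_ _ e3) ellB.
move/cvgrPdist_le : belowI => /(_ _ e3) belowI.
apply: filterS2 ellB belowI => i.
rewrite !ler_norml => /andP[Bi _] /andP[_ di].
apply: (@le_trans _ _ (freq R (multiples B `\` multiples (below B K0)) (ell i))).
  by apply: freq_le; apply: setDS; apply: multiplesS; exact: belowS.
rewrite freq_setD; last by apply: multiplesS; exact: below_sub.
move: DE Bi di; rewrite -/d.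
move: (lower_density R (multiples B)) (freq R (multiples B) _).
move: (freq R _ (ell i)) => x y z; lra.
Qed.

End multiples_tails.

(** * Coprime scalings and arithmetic progressions *)

(** A prime factor of P divides at most one element of A. *)
Lemma pairwise_coprime_avoid (A : set nat) (P : nat) : A `<=` positives ->
  infinite_set A -> pairwise_coprime A -> (0 < P)%N ->
  exists2 a, A a & coprime a P.
Proof.
move=> Apos Ainf Acop P0; apply: contrapT => nA; apply: Ainf.
(* outside of A the values of f exceed P, so that f is only constrained on A *)
pose f a := if a \in A then pdiv (gcdn a P) else (P + a).+1.
have ncop a : A a -> (1 < gcdn a P)%N.
  move=> Aa; rewrite ltn_neqAle gcdn_gt0 P0 orbT andbT eq_sym.
  by apply/negP => cop; apply: nA; exists a.
have fP a : A a -> (f a <= P)%N.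
  move=> Aa; rewrite /f mem_set//; apply: dvdn_leq => //.
  by rewrite (dvdn_trans (pdiv_dvd _))// dvdn_gcdr.
have fE : f @^-1` [set p | (p <= P)%N] = A.
  apply/seteqP; split=> a; last exact: fP.
  rewrite /= /f; case: ifPn => [/set_mem//|_]; lia.
rewrite -fE; apply: finite_preimage; last first.
  by apply: (sub_finite_set _ (finite_II P.+1)) => p /=; rewrite ltnS.
rewrite fE => a b /set_mem Aa /set_mem Ab; rewrite /f !mem_set// => pE.
apply: contrapT => ab; have := Acop _ _ Aa Ab ab.
have pa : (pdiv (gcdn a P) %| a)%N by rewrite (dvdn_trans (pdiv_dvd _))// dvdn_gcdl.
have pb : (pdiv (gcdn a P) %| b)%N by rewrite pE (dvdn_trans (pdiv_dvd _))// dvdn_gcdl.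
rewrite /coprime => /eqP ab1.
have : (pdiv (gcdn a P) %| 1)%N by rewrite -ab1 dvdn_gcd pa.
by rewrite dvdn1 => /eqP p1; have := pdiv_prime (ncop _ Aa); rewrite p1.
Qed.

(** Chinese remainder theorem along the list s. The last conclusion, with A
    coprime to P0, serves to show that an integer having a common prime with A
    cannot divide e + j for an index j outside s but at a small distance. *)
Lemma simultaneous_divisors (s : seq int) (S : int -> nat -> Prop) (P0 : nat) :
  (0 < P0)%N ->
  (forall i, i \in s -> forall P, (0 < P)%N ->
     exists a, [/\ (0 < a)%N, coprime a P & S i a]) ->
  exists (A : nat) (e : int), [/\ (0 < A)%N, coprime A P0,
    forall i, i \in s -> exists a, [/\ (a %| A)%N, S i a & (a%:Z %| e + i)%Z] &
    forall p, prime p -> (p %| A)%N -> exists2 i, i \in s & (p%:Z %| e + i)%Z].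
Proof.
move=> P00; elim: s => [|i s IH] hS.
  exists 1%N, 0; split => //; first exact: coprime1n.
  by move=> p pp; rewrite dvdn1 => /eqP p1; rewrite p1 in pp.
have [|A [e [A0 AP eA pA]]] := IH.
  by move=> j js; apply: hS; rewrite inE js orbT.
have [|a [a0]] := hS i (mem_head _ _) (A * P0)%N.
  by rewrite muln_gt0 A0.
rewrite coprimeMr => /andP[aA aP] Sia.
have cAa : coprimez A%:Z a%:Z by rewrite coprimezE !absz_nat coprime_sym.
pose e' := zchinese A%:Z a%:Z e (- i).
have e'A : (A%:Z %| e' - e)%Z.
  by rewrite -eqz_mod_dvd; apply/eqP; exact: zchinese_modl.
have e'a : (a%:Z %| e' + i)%Z.
  by rewrite -[i]opprK -eqz_mod_dvd; apply/eqP; exact: zchinese_modr.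
have transfer d j : (d%:Z %| A%:Z)%Z -> (d%:Z %| e + j)%Z -> (d%:Z %| e' + j)%Z.
  move=> dA dej; rewrite (_ : e' + j = (e' - e) + (e + j)); last by ring.
  by rewrite rpredD// (dvdz_trans dA).
exists (A * a)%N, e'; split.
- by rewrite muln_gt0 A0.
- by rewrite coprimeMl AP.
- move=> j; rewrite inE => /predU1P[->|js]; first by exists a; rewrite dvdn_mull.
  have [d [dA Sjd dej]] := eA _ js; exists d; split => //.
    by rewrite dvdn_mulr.
  exact: transfer.
- move=> p pp; rewrite Euclid_dvdM// => /orP[pA'|pa].
    have [j js pej] := pA _ pp pA'; exists j; first by rewrite inE js orbT.
    exact: transfer.
  exists i; first exact: mem_head.
  by rewrite (dvdz_trans _ e'a).
Qed.

Section independent_progressions.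
Context (R : realType).

Lemma psum_blocks (F : nat -> R) q m : psum F (q * m) =
  \sum_(1 <= n < q.+1) \sum_(0 <= t < m) F (n + q * t)%N.
Proof.
elim: m => [|m IH].
  rewrite muln0 /psum big_geq// big1// => n _; by rewrite big_geq.
rewrite mulnS addnC psumD IH -big_split/=; apply: eq_bigr => n _.
by rewrite big_nat_recr.
Qed.

(** The inverse of q modulo A provides t. *)
Lemma progression_meets (q A : nat) (c : int) : coprime q A -> (0 < A)%N ->
  exists2 t, (t < A)%N & (A%:Z %| q%:Z * t%:Z - c)%Z.
Proof.
move=> qA A0; have : coprimez q%:Z A%:Z by [].
move=> /coprimezP[[u v] /= uv].
have A00 : A%:Z != 0 by rewrite eqz_nat -lt0n.
have t0 := modz_ge0 (c * u) A00.
exists `|(c * u %% A%:Z)%Z|%N.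
  by rewrite -ltz_nat gez0_abs// ltz_pmod// ltz_nat.
rewrite gez0_abs//.
rewrite (_ : _ - c = - (q%:Z * (c * u %/ A%:Z)%Z + c * v) * A%:Z).
  exact: dvdz_mull.
have -> : (c * u %% A%:Z)%Z = c * u - (c * u %/ A%:Z)%Z * A%:Z.
  by apply: (addrI ((c * u %/ A%:Z)%Z * A%:Z)); rewrite -divz_eq; ring.
have vE : v * A%:Z = 1 - u * q%:Z by apply: (addrI (u * q%:Z)); rewrite uv; ring.
by rewrite mulNr mulrDl -(mulrA c v) vE; ring.
Qed.

(** As q is invertible modulo A, the translates of a point of V by 0, q, ...,
    (A - 1) q meet every residue class modulo A. *)
Lemma psum_progression (V : set int) (q A : nat) (e : int) :
  coprime q A -> (0 < A)%N -> zperiodic q V ->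
  psum (indz R V) q <=
  psum (indz R (V `&` [set m | (A%:Z %| m - e)%Z])) (q * A).
Proof.
move=> qA A0 pV; rewrite psum_blocks /psum; apply: ler_sum => n _.
have nn (F : nat -> R) : (forall t, 0 <= F t) -> 0 <= \sum_(0 <= t < A) F t.
  by move=> F0; exact: sumr_ge0.
rewrite {1}/indz; have [/set_mem Vn|_] := boolP (_ \in V); last first.
  by apply: nn => t; case/andP: (indz01 R (V `&` [set m | (A%:Z %| m - e)%Z]) (n + q * t)).
have [t tA At] := progression_meets (e - n%:Z) qA A0.
rewrite (big_rem t)/=; last by rewrite mem_index_iota.
rewrite -[leLHS]addr0 lerD//; last first.
  apply: sumr_ge0 => k _.
  by case/andP: (indz01 R (V `&` [set m | (A%:Z %| m - e)%Z]) (n + q * k)).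
rewrite /indz mem_set//; split => /=.
  elim: (t) => [|k IH]; first by rewrite muln0 addn0.
  by rewrite mulnS addnCA addnC PoszD; apply/pV.
by move: At; rewrite PoszD PoszM; congr (_ %| _)%Z; ring.
Qed.

End independent_progressions.

(** * Patterns between eta_star and eta *)

Section bstar_facts.
Context (B : set nat) (hB : B `<=` positives).

Lemma bstar_candidates : B `|` coprime_scalings B `<=` positives.
Proof. by move=> d [/hB|[]]. Qed.

Lemma bstar_positive : bstar B `<=` positives.
Proof. by move=> d [/bstar_candidates]. Qed.

Lemma primitive_divisor b : B b -> exists2 d, bstar B d & (d %| b)%N.
Proof.
move=> Bb; pose P d := `[< (B `|` coprime_scalings B) d /\ (d %| b)%N >].
have exP : exists d, P d by exists b; apply/asboolP; split => //; left.
have [d /asboolP[Cd db] dmin] := ex_minnP exP; exists d => //; split => // d' Cd' d'd.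
have d0 : (0 < d)%N by exact: bstar_candidates.
apply/eqP; rewrite eqn_leq dvdn_leq//=; apply: dmin; apply/asboolP; split => //.
exact: dvdn_trans db.
Qed.

Lemma multiples_bstar : multiples B `<=` multiples (bstar B).
Proof.
move=> n [b /primitive_divisor[d Dd db] bn]; exists d => //.
by apply: dvdz_trans bn; rewrite dvdzE.
Qed.

Lemma eta_star_le n : eta_star B n -> eta_seq B n.
Proof. by rewrite /eta_star /eta_seq !inE => nm /multiples_bstar. Qed.

Lemma eta_seqP n : reflect (~ multiples B n) (eta_seq B n).
Proof. by rewrite /eta_seq; apply: (iffP idP); rewrite inE. Qed.

(** For d in B, a = 1 will do. *)
Lemma bstar_scalable d P : bstar B d -> (0 < P)%N ->
  exists a, [/\ (0 < a)%N, coprime a P & B (d * a)%N].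
Proof.
move=> [[Bd _|[d0 [A [Apos Ainf Acop AB]]] _] P0].
  by exists 1%N; rewrite coprime1n muln1.
have [a Aa aP] := pairwise_coprime_avoid Apos Ainf Acop P0.
by exists a; split; [exact: Apos| |exact: AB].
Qed.

End bstar_facts.

Section patterns.
Context (R : realType) (B : set nat) (hB : B `<=` positives).

Definition attained_patterns (n : nat) (v : binseq) : set int :=
  [set k | forall i : int, (`|i| <= n)%N ->
    v i = eta_star B (k + i) \/ v i = eta_seq B (k + i)].

(** The places m where no element b <= K of B destroys a one of v. Restricting
    b to be coprime to A makes this condition independent of the residue of m
    modulo A. *)
Definition coprime_sieve (A : nat) (n K : nat) (v : binseq) : set int :=
  [set m | forall (i : int) (b : nat), (`|i| <= n)%N -> v i ->
     B b -> (b <= K)%N -> coprime b A -> ~ (b%:Z %| m + i)%Z].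

Lemma coprime_sieve_zperiodic A n K v q :
  (forall b, B b -> (b <= K)%N -> coprime b A -> (b %| q)%N) ->
  zperiodic q (coprime_sieve A n K v).
Proof.
move=> bq m; have E i b : B b -> (b <= K)%N -> coprime b A ->
    (b%:Z %| m + q%:Z + i)%Z = (b%:Z %| m + i)%Z.
  move=> Bb bK bA; rewrite addrAC rpredDr//.
  by rewrite dvdzE !absz_nat bq.
by split=> h i b ni vi Bb bK bA; [rewrite -E//|rewrite E//]; apply: h.
Qed.

(** Pigeonhole principle over the residue classes modulo Q. The good class may
    vary with i, so that it is good for infinitely many i only. *)
Lemma frequently_class (A : set int) (Q : nat) (ell : nat -> nat) (c : R) :
  (0 < Q)%N -> 0 < c ->
  (\forall i \near \oo, c <= freq R A (ell i)) ->
  exists s : nat, ~ \forall i \near \oo,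
    freq R (A `&` [set m : int | (Q%:Z %| m - s%:Z)%Z]) (ell i) < c / Q%:R.
Proof.
move=> Q0 c0 cA; apply: contrapT => /forallNP small.
have QR : 0 < Q%:R :> R by rewrite ltr0n.
pose F s := A `&` [set m : int | (Q%:Z %| m - s%:Z)%Z].
have bound k : \forall i \near \oo, forall s, (s < k)%N ->
    freq R (F s) (ell i) < c / Q%:R.
  elim: k => [|k IH]; first by apply: nearW.
  have := contrapT (small k); apply: filterS2 IH => i h1 h2 s.
  by rewrite ltnS leq_eqVlt => /predU1P[->//|]; exact: h1.
have freqU k L : freq R (\bigcup_(s in [set s | (s < k)%N]) F s) L <=
    \sum_(0 <= s < k) freq R (F s) L.
  elim: k => [|k IH].
    rewrite big_geq// (_ : \bigcup_(s in _) _ = set0).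
      by rewrite freqE /psum big1 ?mul0r// => n _; rewrite /indz in_set0.
    by rewrite -subset0 => m [].
  rewrite big_nat_recr//=.
  apply: (@le_trans _ _ (freq R (\bigcup_(s in [set s | (s < k)%N]) F s) L +
    freq R (F k) L)); last by rewrite lerD2r.
  apply: le_trans _ (freq_setU R _ _ _); apply: freq_le => m [s /= sk Fs].
  move: sk; rewrite ltnS leq_eqVlt => /predU1P[sk|sk]; last by left; exists s.
  by right; rewrite -sk.
have [N _ hN] : \forall i \near \oo, False.
  have := cA; apply: filterS2 (bound Q) => i h1.
  apply/negP; rewrite -ltNge.
  apply: (@le_lt_trans _ _ (\sum_(0 <= s < Q) freq R (F s) (ell i))).
    apply: le_trans _ (freqU Q _); apply: freq_le => m Am.
    have Q00 : Q%:Z != 0 by rewrite eqz_nat -lt0n.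
    have m0 := modz_ge0 m Q00.
    exists `|(m %% Q%:Z)%Z|%N => /=.
      by rewrite -ltz_nat gez0_abs// ltz_pmod// ltz_nat.
    split => //=; rewrite gez0_abs// {1}(divz_eq m Q%:Z) addrK.
    exact: dvdz_mull.
  (* c is the sum of Q terms c / Q, each larger than the frequency of its class *)
  have -> : c = \sum_(0 <= s < Q) c / Q%:R.
    by rewrite sumr_const_nat subn0 -[RHS]mulr_natr mulfVK// gt_eqF.
  rewrite !big_mkord; apply: ltr_sum => [|s _]; last exact: h1.
  by apply/hasP; exists (Ordinal Q0); rewrite ?mem_index_enum.
exact: (hN N (leqnn N)).
Qed.

(** Outside of a set of small frequency each zero of v is explained by a
    divisor d <= K in bstar B, and these divisors only depend on the class of
    the place modulo Q = K!, which is fixed. A divisor d that is not in B is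
    replaced by a product d a in B, where the a are chosen pairwise coprime
    and coprime to Q and to (2 n)!, and m is moved to places with the right
    residues modulo the a. For an element b of B and a one of v at m + i, a
    common prime of b and a would divide both m + i and m + j for a zero j,
    hence i - j, which is impossible as 0 < |i - j| <= 2 n and the a are
    coprime to (2 n)!. So only the b coprime to the a matter; their condition
    on m is independent of the residues modulo the a, and it holds with
    positive frequency since it holds where v was found. The elements of B
    larger than K' are dealt with by the theorem of Davenport and Erdos. *)
Lemma pattern_occurs (ell : nat -> nat) (n : nat) (v : binseq) (c : R) :
  realizes_lower_density R ell (multiples B) ->
  (forall e : R, 0 < e -> exists K, \forall i \near \oo, freq R
     (multiples (bstar B) `\` multiples (below (bstar B) K)) (ell i) <= e) ->
  0 < c -> (\forall i \near \oo, c <= freq R (attained_patterns n v) (ell i)) ->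
  exists m : int, forall i : int, (`|i| <= n)%N -> eta_seq B (m + i) = v i.
Proof.
move=> ellP star_tail c0 cU; have [ell0 ellI _] := ellP.
have [d d0 thick_small] := freq_thicken n (divr_gt0 c0 (ltr0n R 2)).
have [K tailK] := star_tail _ d0.
have {tailK} tailK := thick_small ell _ ellI tailK.
set T := thicken n _ in tailK.
pose U := attained_patterns n v `\` T.
have cU' : \forall i \near \oo, c / 2 <= freq R U (ell i).
  apply: filterS2 cU tailK => i; have := freq_setU R U T (ell i).
  have : freq R (attained_patterns n v) (ell i) <= freq R (U `|` T) (ell i).
    apply: freq_le => k Uk; have [Tk|nTk] := pselect (T k); by [right|left].
  move: (freq R U _) (freq R T _) (freq R (_ `|` _) _) (freq R _ _).
  by move=> x y z t; lra.
pose Q := K`!; have Q0 : (0 < Q)%N by exact: fact_gt0.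
have c20 : 0 < c / 2 by rewrite divr_gt0.
have [s often] := frequently_class Q0 c20 cU'.
set C := U `&` _ in often.
pose c' := c / 2 / Q%:R; have c'0 : 0 < c' by rewrite divr_gt0// ltr0n.
have [k0 [Uk0 Ck0]] : exists k, C k.
  apply: contrapT => /forallNP nC; apply: often; apply: nearW => i.
  rewrite (_ : C = set0); last by rewrite -subset0 => k /nC.
  by rewrite freqE /psum big1 ?mul0r// => m _; rewrite /indz in_set0.
have onesU k i : U k -> (`|i| <= n)%N -> v i -> eta_seq B (k + i).
  move=> [/(_ i) + _] ni vi => /(_ ni); rewrite vi => -[e|<-//].
  by apply: eta_star_le => //; rewrite -e.
have zeros i : (`|i| <= n)%N -> ~~ v i -> exists d, [/\ bstar B d, (d %| Q)%N &
    (d%:Z %| k0 + i)%Z].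
  move=> ni nvi; have nstar : ~~ eta_star B (k0 + i).
    have [/(_ i ni)[<-//|e] _] := Uk0.
    by apply: contra nvi => /(eta_star_le hB); rewrite e.
  have Ms : multiples (bstar B) (k0 + i).
    by apply: contrapT => nM; move/negP : nstar; apply; apply/eta_seqP.
  have : multiples (below (bstar B) K) (k0 + i).
    by apply: contrapT => nM; case: Uk0 => _; apply; exists i.
  move=> [d' [Dd' d'K] d'k]; exists d'; split => //.
  by rewrite dvdn_fact// d'K andbT; exact: (bstar_positive hB).
pose zs := [seq i <- [seq k%:Z - n%:Z | k <- iota 0 (n + n).+1] | ~~ v i].
have zsP i : reflect ((`|i| <= n)%N /\ ~~ v i) (i \in zs).
  apply: (iffP idP); rewrite mem_filter.
    by move=> /andP[nvi /mapP[k]]; rewrite mem_iota => kn iE; subst i; split => //; lia.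
  move=> [ni nvi]; rewrite nvi andTb; apply/mapP; exists (absz (i + n%:Z)%R); last lia.
  by rewrite mem_iota; lia.
have P0 : (0 < Q * (n + n)`!)%N by rewrite muln_gt0 Q0 fact_gt0.
pose S i a := exists d, [/\ B (d * a)%N, (d %| Q)%N & (d%:Z %| k0 + i)%Z].
have [|A [e [A0 AP eA pA]]] := simultaneous_divisors (s := zs) (S := S) P0.
  move=> i /zsP[ni nvi] P Ppos; have [d' [Dd' d'Q d'k]] := zeros i ni nvi.
  have [a [a0 aP Ba]] := bstar_scalable Dd' Ppos.
  by exists a; split => //; exists d'.
have /andP[AQ An] : coprime A Q && coprime A (n + n)`! by rewrite -coprimeMr.
have AR : 0 < A%:R :> R by rewrite ltr0n.
have cA0 : 0 < c' / A%:R by exact: divr_gt0.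
have c4 : 0 < c' / A%:R / 4 by apply: divr_gt0.
have [d2 d20 thick_small2] := freq_thicken n c4.
have [K' tailK'] := multiples_tail hB d20.
have {tailK'} tailK' := thick_small2 ell _ ellI (tailK' K' ell (leqnn K') ellP).
(* a period of the sieve that is coprime to A *)
pose q := (Q * \prod_(1 <= b < K'.+1 | coprime b A) b)%N.
have qA : coprime q A.
  rewrite coprimeMl coprime_sym AQ /=; elim/big_ind: _ => //.
    by rewrite coprime1n.
  by move=> x y xA yA; rewrite coprimeMl xA.
have q0 : (0 < q)%N.
  rewrite muln_gt0 Q0 /=; rewrite big_nat_cond; apply: prodn_cond_gt0 => b.
  by move=> /andP[/andP[]].
pose V := coprime_sieve A n K' v `&` [set m : int | (Q%:Z %| m - s%:Z)%Z].
have Qq : (Q%:Z %| q%:Z)%Z by rewrite dvdzE !absz_nat dvdn_mulr.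
have pV : zperiodic q V.
  have pS : zperiodic q (coprime_sieve A n K' v).
    apply: coprime_sieve_zperiodic => b Bb bK bA; rewrite /q dvdn_mull//.
    rewrite (big_rem b)/=; first by rewrite bA dvdn_mulr.
    by rewrite mem_index_iota ltnS bK andbT; exact: hB.
  move=> m; rewrite /V /=; split=> -[/pS Vm Qm]; split => //.
    by move: Qm; rewrite /= addrAC rpredDr.
  by rewrite /= addrAC rpredDr.
have CV : C `<=` V.
  move=> k [Uk Qk]; split => // i b ni vi Bb bK bA bk.
  have /eta_seqP := onesU k i Uk ni vi; apply.
  by exists b.
have densV : c' <= psum (indz R V) q / q%:R.
  rewrite leNgt; apply/negP => Vc; apply: often.
  have [N _ hN] := cvgr_lt _ (zperiodic_cvg q0 pV ellI) _ Vc.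
  by exists N => // i Ni; apply: le_lt_trans (hN i Ni); exact: freq_le.
pose W := V `&` [set m | (A%:Z %| m - e)%Z].
have pW : zperiodic (q * A) W.
  move=> m; rewrite PoszM; have VqA : V (m + q%:Z * A%:Z) <-> V m.
    elim: (A) => [|k IH]; first by rewrite mulr0 addr0.
    apply: iff_trans IH; rewrite intS mulrDr mulr1 addrCA addrC; exact: pV.
  have AqA : (A%:Z %| m + q%:Z * A%:Z - e)%Z = (A%:Z %| m - e)%Z.
    by rewrite addrAC rpredDr// dvdz_mull.
  by rewrite /W /setI /= AqA; split=> -[/VqA].
have qA0 : (0 < q * A)%N by rewrite muln_gt0 q0.
have densW : c' / A%:R / 2 < psum (indz R W) (q * A) / (q * A)%:R.
  apply: (@lt_le_trans _ _ (c' / A%:R)).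
    by move: cA0; move: (c' / A%:R) => x; lra.
  rewrite natrM invfM mulrA ler_wpM2r ?invr_ge0//.
  apply: (le_trans densV); rewrite ler_wpM2r ?invr_ge0//.
  exact: psum_progression.
have [m [[[Vm Qm] Am] nTm]] : exists m, W m /\
    ~ thicken n (multiples B `\` multiples (below B K')) m.
  have [N _ hN] := cvgr_gt _ (zperiodic_cvg qA0 pW ellI) _ densW.
  have [N' _ hN'] := tailK'.
  apply: (@freq_lt_exists R W _ (ell (maxn N N'))).
  apply: le_lt_trans (hN' _ (leq_maxr _ _)) (lt_trans _ (hN _ (leq_maxl _ _))).
  by move: cA0; move: (c' / A%:R) => x; lra.
exists m => i ni; case: (boolP (v i)) => [vi|nvi].
  apply/eta_seqP => Bm.
  have [b [Bb bK] bm] : multiples (below B K') (m + i).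
    by apply: contrapT => nb; apply: nTm; exists i.
  have nbA : ~ coprime b A by move=> bA; exact: (Vm i b).
  have g1 : (1 < gcdn b A)%N.
    rewrite ltn_neqAle gcdn_gt0 A0 orbT andbT eq_sym; exact/negP.
  have pp := pdiv_prime g1; set p := pdiv _ in pp.
  have pb : (p %| b)%N by rewrite (dvdn_trans (pdiv_dvd _))// dvdn_gcdl.
  have pA' : (p %| A)%N by rewrite (dvdn_trans (pdiv_dvd _))// dvdn_gcdr.
  have [j /zsP[nj nvj] pej] := pA _ pp pA'.
  have pij : (p%:Z %| i - j)%Z.
    rewrite (_ : i - j = (m + i) - (m - e) - (e + j)); last by ring.
    rewrite rpredB// rpredB//; first exact: dvdz_trans bm.
    exact: dvdz_trans Am.
  have ij : i != j by apply: contra nvj => /eqP <-.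
  have : (p %| (n + n)`!)%N.
    rewrite dvdn_fact// prime_gt0//=.
    have : (p <= `|i - j|)%N by apply: dvdn_leq pij; rewrite absz_gt0 subr_eq0.
    by move: ni nj; clear; lia.
  move=> pn; have : (p %| gcdn A (n + n)`!)%N by rewrite dvdn_gcd pA'.
  by rewrite (eqP An) dvdn1 => /eqP p1; rewrite p1 in pp.
have [a [aA [d' [Bda d'Q d'k]] ae]] := eA i (introT (zsP i) (conj ni nvi)).
apply/negbTE/negP => /eta_seqP; apply; exists (d' * a)%N => //.
have d'Qz : (d'%:Z %| Q%:Z)%Z by [].
have d'm : (d'%:Z %| m + i)%Z.
  rewrite (_ : m + i = (m - s%:Z) - (k0 - s%:Z) + (k0 + i)); last by ring.
  by rewrite rpredD// rpredB// (dvdz_trans d'Qz).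
have am : (a%:Z %| m + i)%Z.
  rewrite (_ : m + i = (m - e) + (e + i)); last by ring.
  by rewrite rpredD// (dvdz_trans _ Am).
rewrite PoszM Gauss_dvdz ?d'm ?am//.
rewrite coprimezE !absz_nat; apply: coprime_dvdl d'Q _.
by rewrite coprime_sym; exact: coprime_dvdl aA AQ.
Qed.

End patterns.

(** * Pairs of sequences approximated by periodic pairs *)

Definition shift2 (n : int) (p : binseq * binseq) : binseq * binseq :=
  (zshift n p.1, zshift n p.2).

Lemma zshiftD m n x : zshift m (zshift n x) = zshift (m + n) x.
Proof. by apply/funext => k; rewrite /zshift -addrA. Qed.

Lemma shift2D m n p : shift2 m (shift2 n p) = shift2 (m + n) p.
Proof. by rewrite /shift2 /= !zshiftD. Qed.

Lemma zshift0 x : zshift 0 x = x.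
Proof. by apply/funext => k; rewrite /zshift addr0. Qed.

Lemma iter_sigma l x : iter l sigma x = zshift l x.
Proof.
elim: l => [|l IH]; first by rewrite zshift0.
by rewrite iterS IH /sigma zshiftD -PoszD.
Qed.

Lemma iter_prod_map (X Y : Type) (S : X -> X) (T : Y -> Y) l p :
  iter l (prod_map S T) p = (iter l S p.1, iter l T p.2).
Proof. by elim: l => [|l IH]; [case: p|rewrite !iterS IH]. Qed.

Lemma iter_shift2 l p : iter l (prod_map sigma sigma) p = shift2 l p.
Proof. by rewrite iter_prod_map !iter_sigma. Qed.

Definition pair_eq := prod_eq window_eq window_eq.

Lemma resolution_pair : resolution pair_eq.
Proof. exact: resolution_prod resolution_window resolution_window. Qed.

Lemma pair_compact : compact [set: (binseq * binseq)%type].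
Proof. exact: prod_compact binseq_compact binseq_compact. Qed.

Definition visits (C : set (binseq * binseq)) (p : binseq * binseq) : set int :=
  [set n | C (shift2 n p)].

Definition disagreement (p p' : binseq * binseq) : set int :=
  [set n | ~ (p.1 n = p'.1 n /\ p.2 n = p'.2 n)].

Lemma visits_approx n (C : set (binseq * binseq)) p p' : saturated pair_eq n C ->
  visits C p `<=` visits C p' `|` thicken n (disagreement p p').
Proof.
move=> sC k Ck; have [|nT] := pselect (thicken n (disagreement p p') k).
  by right.
left; apply: sC Ck; split => i ni; rewrite /= /zshift addrC;
  by (have [] : p.1 (k + i) = p'.1 (k + i) /\ p.2 (k + i) = p'.2 (k + i)
    by apply: contrapT => neq; apply: nT; exists i).
Qed.

Lemma disagreementC p p' : disagreement p p' = disagreement p' p.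
Proof. by apply/seteqP; split=> n h [e1 e2]; apply: h. Qed.

Section periodic_approximation.
Context (R : realType).

Lemma orbit_mean_visits (C : set (binseq * binseq)) p L :
  orbit_mean (prod_map sigma sigma) p L (\1_C : _ -> R) = freq R (visits C p) L.
Proof.
rewrite freqE /orbit_mean mulrC; congr (_ / _); apply: eq_bigr => l _.
by rewrite iter_shift2 indicE /indz; congr (_%:R); apply/idP/idP; rewrite !inE.
Qed.

Lemma orbit_mean_sigma (C : set binseq) x L :
  orbit_mean sigma x L (\1_C : _ -> R) = freq R [set n | C (zshift n x)] L.
Proof.
rewrite freqE /orbit_mean mulrC; congr (_ / _); apply: eq_bigr => l _.
by rewrite iter_sigma indicE /indz; congr (_%:R); apply/idP/idP; rewrite !inE.
Qed.

Lemma freq_visits_dist n (C : set (binseq * binseq)) p p' L :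
  saturated pair_eq n C ->
  `|freq R (visits C p) L - freq R (visits C p') L| <=
    freq R (thicken n (disagreement p p')) L.
Proof.
move=> sC.
have h := le_trans (freq_le R L (visits_approx (p := p) p' sC))
  (freq_setU R _ _ L).
have := le_trans (freq_le R L (visits_approx (p := p') p sC))
  (freq_setU R _ _ L).
rewrite (disagreementC p') ler_distl => h'.
by rewrite lerBlDr h' addrC -lerBlDl lerBlDl addrC h.
Qed.

Definition period_freq (q : nat) (p : binseq * binseq)
    (C : set (binseq * binseq)) : R :=
  psum (indz R (visits C p)) q / q%:R.

Definition pair_periodic (q : nat) (p : binseq * binseq) :=
  forall n : int, p.1 (n + q%:Z) = p.1 n /\ p.2 (n + q%:Z) = p.2 n.

Lemma shift2_periodic q p n : pair_periodic q p ->
  shift2 (n + q%:Z) p = shift2 n p.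
Proof.
move=> pp; rewrite /shift2; congr pair; apply/funext => k; rewrite /zshift addrA.
  by have [] := pp (k + n).
by have [] := pp (k + n).
Qed.

Lemma visits_zperiodic q p C : pair_periodic q p -> zperiodic q (visits C p).
Proof. by move=> pp n; rewrite /visits/= shift2_periodic. Qed.

Lemma period_freq_ge0 q p C : 0 <= period_freq q p C.
Proof.
by rewrite divr_ge0// psum_ge0// => n; case/andP: (indz01 R (visits C p) n).
Qed.

Lemma period_freqT q p : (0 < q)%N -> period_freq q p setT = 1.
Proof.
move=> q0; rewrite /period_freq /psum (eq_bigr (fun _ => 1)); last first.
  by move=> n _; rewrite /indz mem_set.
by rewrite sumr_const_nat subSS subn0 divff// pnatr_eq0 -lt0n.
Qed.

Lemma period_freqU q p C C' : C `&` C' = set0 ->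
  period_freq q p (C `|` C') = period_freq q p C + period_freq q p C'.
Proof.
move=> CC'; rewrite -mulrDl -big_split/=; congr (_ / _); apply: eq_bigr => n _.
rewrite /indz; set s := shift2 n p.
have E D : (n%:Z \in visits D p) = (s \in D) by apply/idP/idP; rewrite !inE.
rewrite !E in_setU; case: (boolP (s \in C)) => [/set_mem Cs|_]; last by rewrite add0r.
rewrite memNset ?addr0// => C's.
by have : (C `&` C') s by []; rewrite CC'.
Qed.

Lemma period_freq_shift q p (C : set (binseq * binseq)) : pair_periodic q p ->
  period_freq q p (prod_map sigma sigma @^-1` C) = period_freq q p C.
Proof.
move=> pp; congr (_ / _).
rewrite -(psum_shift 1 (zperiodic_indz R (visits_zperiodic C pp))).
apply: eq_bigr => n _; rewrite /indz.
have E : prod_map sigma sigma (shift2 n p) = shift2 (n + 1)%N p.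
  by rewrite PoszD addrC -shift2D.
have -> // : (n%:Z \in visits (prod_map sigma sigma @^-1` C) p) =
    ((n + 1)%N%:Z \in visits C p).
by apply/idP/idP; rewrite !inE /visits/= -E.
Qed.

Context (p : binseq * binseq) (pj : nat -> binseq * binseq) (q : nat -> nat).
Hypotheses (q0 : forall j, (0 < q j)%N)
  (pp : forall j, pair_periodic (q j) (pj j)).

Definition approximated (ell : nat -> nat) := ell i @[i --> \oo] --> \oo /\
  forall e : R, 0 < e -> exists J, forall j, (J <= j)%N ->
    \forall i \near \oo, freq R (disagreement p (pj j)) (ell i) <= e.

Let pf j C := period_freq (q j) (pj j) C.

Lemma approximated_dist ell C (e : R) : clopen C -> approximated ell -> 0 < e ->
  exists J, forall j, (J <= j)%N ->
    \forall i \near \oo, `|freq R (visits C p) (ell i) - pf j C| <= e.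
Proof.
move=> cC [ellI app] e0.
have [n sC] := clopen_saturated resolution_pair pair_compact cC.
have e2 : 0 < e / 2 by rewrite divr_gt0.
have [d d0 thick_small] := freq_thicken n e2.
have [J hJ] := app d d0; exists J => j /hJ /(thick_small _ _ ellI) small.
have per := zperiodic_cvg (R := R) (q0 j) (visits_zperiodic C (pp j)) ellI.
move/cvgrPdist_le : per => /(_ _ e2); apply: filterS2 small => i h1 h2.
rewrite -(subrKA (freq R (visits C (pj j)) (ell i))).
rewrite (le_trans (ler_normD _ _))// (splitr e) lerD//.
  exact: le_trans (freq_visits_dist _ _ _ sC) h1.
by rewrite distrC.
Qed.

Lemma period_freq_lim ell C (l : R) : clopen C -> approximated ell ->
  freq R (visits C p) (ell i) @[i --> \oo] --> l -> pf j C @[j --> \oo] --> l.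
Proof.
move=> cC app cvl; apply/cvgrPdist_le => e e0.
have e2 : 0 < e / 2 by rewrite divr_gt0.
have [J hJ] := approximated_dist cC app e2; exists J => // j /= /hJ [N _ hN].
move/cvgrPdist_le : cvl => /(_ _ e2)[N' _ hN'].
rewrite -(subrKA (freq R (visits C p) (ell (maxn N N')))).
rewrite (le_trans (ler_normD _ _))// (splitr e) lerD//.
  by apply: hN'; exact: leq_maxr.
by apply: hN; exact: leq_maxl.
Qed.

Lemma approximated_lim ell C (l : R) : clopen C -> approximated ell ->
  pf j C @[j --> \oo] --> l -> freq R (visits C p) (ell i) @[i --> \oo] --> l.
Proof.
move=> cC app cvl; apply/cvgrPdist_le => e e0.
have e2 : 0 < e / 2 by rewrite divr_gt0.
have [J hJ] := approximated_dist cC app e2.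
move/cvgrPdist_le : cvl => /(_ _ e2)[N _ hN].
have := hJ (maxn J N) (leq_maxl _ _); apply: filterS => i h1.
rewrite -(subrKA (pf (maxn J N) C)).
rewrite (le_trans (ler_normD _ _))// (splitr e) lerD//.
  by apply: hN; exact: leq_maxr.
by rewrite distrC.
Qed.

(** For large j the density of the visits of the periodic pair number j to a
    clopen set is close to the frequency of the visits of p along ell. So
    these densities form a Cauchy sequence, and their limits are finitely
    additive. *)
Lemma limit_measure ell : approximated ell ->
  exists rho : probability (borel (binseq * binseq)%type) R,
    Defs.invariant (prod_map sigma sigma) rho /\
    forall C, clopen C -> pf j C @[j --> \oo] --> fine (rho C).
Proof.
move=> app.
have cv C : clopen C -> cvgn (pf ^~ C).
  move=> cC; apply: cauchy_cvg; apply/cauchy_exP => e e0.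
  have e3 : 0 < e / 3 by rewrite divr_gt0.
  have [J hJ] := approximated_dist cC app e3.
  exists (pf J C); exists J => // j /= Jj; rewrite /ball/=.
  have [N _ hN] := hJ J (leqnn J); have [N' _ hN'] := hJ j Jj.
  have h1 := hN _ (leq_maxl N N'); have h2 := hN' _ (leq_maxr N N').
  rewrite -(subrKA (freq R (visits C p) (ell (maxn N N')))).
  rewrite (le_lt_trans (ler_normD _ _))//.
  rewrite (@le_lt_trans _ _ (e / 3 + e / 3)) ?lerD// 1?distrC//.
  by lra.
pose m C : R := lim (pf j C @[j --> \oo]).
have m0 C : clopen C -> 0 <= m C.
  by move=> /cv cC; apply: limr_ge => //; apply: nearW => j; exact: period_freq_ge0.
have mT : m setT = 1.
  apply/cvg_lim => //; apply: cvg_near_cst; apply: nearW => j.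
  exact: period_freqT.
have mU A C : clopen A -> clopen C -> A `&` C = set0 -> m (A `|` C) = m A + m C.
  move=> /cv cA /cv cC AC; apply/cvg_lim => //.
  under eq_fun do rewrite /pf period_freqU//.
  exact: cvgD.
have [rho rhoE] := clopen_extension resolution_pair pair_compact m0 mT mU.
exists rho; split; last by move=> C cC; rewrite rhoE//; exact: cv.
apply: (is_pushforward_clopen resolution_pair).
  by apply: prod_map_continuous; exact: sigma_continuous.
move=> C cC; rewrite !rhoE//; last first.
  apply: preimage_clopen cC _.
  by apply: prod_map_continuous; exact: sigma_continuous.
congr (_%:E); congr (lim _); congr (_ @ \oo).
by apply/funext => j; rewrite /pf period_freq_shift.
Qed.

End periodic_approximation.

(** * The Mirsky measures and their joining *)

Section approximants.
Context (R : realType) (B : set nat) (hB : B `<=` positives).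
Hypothesis hreg : regular_toeplitz R (eta_star B).

Definition periodic_part (x : binseq) (j : nat) : set int :=
  \bigcup_(s in [set s | (1 <= s <= j)%N]) Per x s.

Definition lower_approx (j : nat) : binseq :=
  fun n => eta_star B n && (n \in periodic_part (eta_star B) j).

Definition upper_approx (j : nat) : binseq := eta_seq (below B j).

Lemma Per_translate x s c i : Per x s i -> Per x s (i + s%:Z * c).
Proof. by move=> xi k; rewrite -addrA -mulrDr !xi. Qed.

Lemma periodic_part_zperiodic x j : zperiodic j`! (periodic_part x j).
Proof.
have fact_mul s : (1 <= s <= j)%N -> exists c : int, j`!%:Z = s%:Z * c.
  move=> /dvdn_fact/dvdnP[c jE]; exists c; by rewrite jE mulnC PoszM.
move=> i; split=> -[s sj Pi]; have [c cE] := fact_mul s sj; exists s => //.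
  by have := Per_translate (- c) Pi; rewrite cE mulrN addrK.
by rewrite cE; exact: Per_translate.
Qed.

Lemma eta_star_periodic_part j n : periodic_part (eta_star B) j n ->
  eta_star B (n + j`!%:Z) = eta_star B n.
Proof.
move=> [s sj Pn]; have /dvdnP[c ->] := dvdn_fact sj.
by rewrite mulnC PoszM Pn.
Qed.

Lemma lower_approx_periodic j n : lower_approx j (n + j`!%:Z) = lower_approx j n.
Proof.
rewrite /lower_approx; have pP := periodic_part_zperiodic (eta_star B) j n.
have [/set_mem h|h] := boolP (n \in periodic_part (eta_star B) j).
  by rewrite mem_set ?eta_star_periodic_part//; apply/pP.
rewrite memNset ?andbF// => /pP /mem_set h'; by rewrite h' in h.
Qed.

Lemma upper_approx_periodic j n : upper_approx j (n + j`!%:Z) = upper_approx j n.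
Proof.
rewrite /upper_approx; have pP := below_zperiodic j hB n.
by apply/eta_seqP/eta_seqP => h /pP.
Qed.

Lemma lower_approx_le j n : lower_approx j n -> eta_star B n.
Proof. by case/andP. Qed.

Lemma approx_pair_periodic j :
  pair_periodic j`! (lower_approx j, upper_approx j).
Proof.
by move=> n; rewrite /= lower_approx_periodic upper_approx_periodic.
Qed.

Lemma approx_lower_periodic j :
  pair_periodic j`! (lower_approx j, lower_approx j).
Proof. by move=> n; rewrite /= !lower_approx_periodic. Qed.

(** The periodic part is periodic, so that its density is its asymptotic
    frequency along every ell. *)
Lemma periodic_part_freq (e : R) : 0 < e -> exists J, forall j ell,
  (J <= j)%N -> ell i @[i --> \oo] --> \oo ->
  \forall i \near \oo, freq R (~` periodic_part (eta_star B) j) (ell i) <= e.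
Proof.
move=> e0; have [_ dens] := hreg; have e2 : 0 < e / 2 by rewrite divr_gt0.
move/cvgrPdist_le : dens => /(_ _ e2)[J _ hJ]; exists J => j ell Jj ellI.
have pP := periodic_part_zperiodic (eta_star B) j.
have F0 := fact_gt0 j.
have idI : (fun n : nat => n) @ \oo --> \oo by exact: cvg_id.
have densE : density R (periodic_part (eta_star B) j) =
    psum (indz R (periodic_part (eta_star B) j)) j`! / j`!%:R.
  by apply/cvg_lim => //; exact: zperiodic_cvg idI.
have := hJ j Jj; rewrite /= -/(periodic_part _ _) densE => hd.
have := zperiodic_cvg (R := R) F0 pP ellI.
move/cvgrPdist_le => /(_ _ e2) h1.
have ell_pos : \forall i \near \oo, (0 < ell i)%N.
  by apply: (ellI [set n | (0 < n)%N]); exists 1%N.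
apply: filterS2 h1 ell_pos => i h2 li; rewrite -setTD freq_setD//.
have -> : freq R setT (ell i) = 1.
  rewrite freqE /psum (eq_bigr (fun _ => 1)); last first.
    by move=> n _; rewrite /indz mem_set.
  by rewrite sumr_const_nat subSS subn0 divff// pnatr_eq0 -lt0n.
move: h2 hd; set d := psum _ _ / _; rewrite !ler_norml.
move: (freq R _ _) => x; move=> /andP[_ h2] /andP[_ h3].
rewrite lerBlDr -lerBlDl.
by move: h2 h3; lra.
Qed.

Lemma approximated_star (ell : nat -> nat) : ell i @[i --> \oo] --> \oo ->
  approximated R (eta_star B, eta_star B)
    (fun j => (lower_approx j, lower_approx j)) ell.
Proof.
move=> ellI; split => // e /periodic_part_freq[J hJ]; exists J => j Jj.
apply: filterS (hJ j ell Jj ellI) => i; apply: le_trans; apply: freq_le => n.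
by apply: contra_not => Pn; rewrite /lower_approx /= (mem_set Pn) andbT.
Qed.

(** The first coordinates differ outside of the periodic part, the second ones
    at the multiples of B that are not multiples of [below B j]. *)
Lemma approximated_pair (ell : nat -> nat) :
  realizes_lower_density R ell (multiples B) ->
  approximated R (eta_star B, eta_seq B)
    (fun j => (lower_approx j, upper_approx j)) ell.
Proof.
move=> ellP; have [_ ellI _] := ellP; split => // e e0.
have e2 : 0 < e / 2 by rewrite divr_gt0.
have [J hJ] := periodic_part_freq e2; have [J' hJ'] := multiples_tail hB e2.
exists (maxn J J') => j; rewrite geq_max => /andP[Jj J'j].
apply: filterS2 (hJ j ell Jj ellI) (hJ' j ell J'j ellP) => i h1 h2.
rewrite (splitr e); apply: le_trans (lerD h1 h2).
apply: le_trans (freq_setU R _ _ _); apply: freq_le => n nag.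
have [Pn|] := pselect (periodic_part (eta_star B) j n); last by left.
right; apply: contrapT => nM; apply: nag; split => /=.
  by rewrite /lower_approx (mem_set Pn) andbT.
rewrite /upper_approx; apply/eta_seqP/eta_seqP => [h M|h M].
  by apply: h; apply: multiplesS M; exact: below_sub.
by apply: h; apply: contrapT => nb; apply: nM.
Qed.

Lemma exists_realizing (A : set int) :
  exists ell, realizes_lower_density R ell A.
Proof.
by have [ell [? ? ?]] := limn_inf_subsequence (freq01 R A); exists ell.
Qed.

Lemma star_measure : exists rho : probability (borel (binseq * binseq)%type) R,
  (forall C, clopen C -> period_freq R j`! (lower_approx j, lower_approx j) C
    @[j --> \oo] --> fine (rho C)) /\
  forall ell, ell i @[i --> \oo] --> \oo -> forall C, clopen C ->
    freq R (visits C (eta_star B, eta_star B)) (ell i) @[i --> \oo]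
      --> fine (rho C).
Proof.
have idI : (fun n : nat => n) @ \oo --> \oo by exact: cvg_id.
have [rho [_ rhoE]] := limit_measure fact_gt0 approx_lower_periodic
  (approximated_star idI).
exists rho; split => // ell ellI C cC.
exact: (approximated_lim fact_gt0 approx_lower_periodic cC
  (approximated_star ellI) (rhoE C cC)).
Qed.

Lemma pair_measure : exists rho : probability (borel (binseq * binseq)%type) R,
  [/\ Defs.invariant (prod_map sigma sigma) rho,
   forall C, clopen C -> period_freq R j`! (lower_approx j, upper_approx j) C
    @[j --> \oo] --> fine (rho C) &
  forall ell, realizes_lower_density R ell (multiples B) -> forall C, clopen C ->
    freq R (visits C (eta_star B, eta_seq B)) (ell i) @[i --> \oo]
      --> fine (rho C)].
Proof.
have [ell ellP] := exists_realizing (multiples B).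
have [rho [rhoI rhoE]] := limit_measure fact_gt0 approx_pair_periodic
  (approximated_pair ellP).
exists rho; split => // ell' ellP' C cC.
exact: (approximated_lim fact_gt0 approx_pair_periodic cC
  (approximated_pair ellP') (rhoE C cC)).
Qed.

(** Since eta_star is generic along every sequence, the multiples of bstar B
    have a natural density. Every ell realizes it, and the theorem of
    Davenport and Erdos applies to bstar B. *)
Lemma bstar_tail (ell : nat -> nat) : (forall i, (0 < ell i)%N) ->
  ell i @[i --> \oo] --> \oo ->
  forall e : R, 0 < e -> exists K, \forall i \near \oo, freq R
     (multiples (bstar B) `\` multiples (below (bstar B) K)) (ell i) <= e.
Proof.
move=> ell0 ellI e e0; have [rho [_ cvg_freq]] := star_measure.
pose C : set (binseq * binseq) := [set p | p.1 0 = false].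
have cC : clopen C.
  apply: (saturated_clopen resolution_pair (n := 0%N)) => p p' [/(_ 0 isT) e1 _].
  by rewrite /C /= -e1.
have CE : visits C (eta_star B, eta_star B) = multiples (bstar B).
  apply/seteqP; split=> n; rewrite /visits /C /= /zshift add0r.
    by move=> h; apply: contrapT => /eta_seqP; rewrite -/(eta_star B) h.
  by move=> h; apply/negbTE/negP => /eta_seqP.
have idI : (fun n : nat => n) @ \oo --> \oo by exact: cvg_id.
have lE := (cvg_limn_inf_sup (cvg_freq _ idI C cC)).1.
have ellP : realizes_lower_density R ell (multiples (bstar B)).
  split => //; have := cvg_freq _ ellI C cC.
  by rewrite CE /lower_density -CE lE.
have [K hK] := multiples_tail (bstar_positive hB) e0.
by exists K; exact: hK.
Qed.

Lemma fst_continuous (X Y : ptopologicalType) : continuous (fst : X * Y -> X).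
Proof. by move=> p; exact: cvg_fst. Qed.

Lemma snd_continuous (X Y : ptopologicalType) : continuous (snd : X * Y -> Y).
Proof. by move=> p; exact: cvg_snd. Qed.

Lemma marginal (f : binseq * binseq -> binseq)
    (rho : probability (borel (binseq * binseq)%type) R) : continuous f ->
  exists nu : probability (borel binseq) R,
    forall C, clopen C -> fine (nu C) = fine (rho (f @^-1` C)).
Proof.
move=> cf; pose m C : R := fine (rho (f @^-1` C)).
have m0 C : clopen C -> 0 <= m C by move=> _; exact: fine_ge0.
have mT : m setT = 1 by rewrite /m preimage_setT probability_setT.
have mU A C : clopen A -> clopen C -> A `&` C = set0 -> m (A `|` C) = m A + m C.
  move=> cA cC AC; rewrite /m preimage_setU measureU.
  - by rewrite fineD// fin_num_measure//; apply: borel_clopen; exact: preimage_clopen.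
  - by apply: borel_clopen; exact: preimage_clopen.
  - by apply: borel_clopen; exact: preimage_clopen.
  - by rewrite -preimage_setI AC preimage_set0.
have [nu nuE] := clopen_extension resolution_window binseq_compact m0 mT mU.
by exists nu => C cC; rewrite nuE.
Qed.

Lemma fine_prob_inj (X Y : ptopologicalType) (mu : probability (borel X) R)
    (nu : probability (borel Y) R) A C :
  measurable (A : set (borel X)) -> measurable (C : set (borel Y)) ->
  fine (mu A) = fine (nu C) -> mu A = nu C.
Proof.
by move=> mA mC e; rewrite -[LHS]fineK ?fin_num_measure// e fineK ?fin_num_measure.
Qed.

(** Some sequence realizes the lower density, and along it the frequencies of
    visits have only one limit. *)
Lemma mirsky_quasi_generic (A : set nat) (nu : probability (borel binseq) R) :
  (forall ell, realizes_lower_density R ell (multiples A) ->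
    forall C : set binseq, clopen C ->
    freq R [set n | C (zshift n (eta_seq A))] (ell i) @[i --> \oo] --> fine (nu C)) ->
  forall C : set binseq, clopen C -> mirsky R A C = nu C.
Proof.
move=> nuE C cC; have mC := borel_clopen cC.
pose P := [set nu : probability (borel binseq) R |
  forall ell, realizes_lower_density R ell (multiples A) ->
    quasi_generic sigma (eta_seq A) ell nu].
have P_nu : P nu.
  move=> ell ellP; apply: (quasi_generic_clopen resolution_window binseq_compact).
  move=> D cD; under eq_fun do rewrite orbit_mean_sigma.
  exact: nuE.
have P_mirsky : P (mirsky R A) by exact: getI P_nu.
have [ell ellP] := exists_realizing (multiples A).
apply: fine_prob_inj => //.
have := quasi_generic_indic cC (P_mirsky ell ellP).
under eq_fun do rewrite orbit_mean_sigma.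
move=> h1; apply: (cvg_unique _ h1 (nuE ell ellP C cC)); exact: Rhausdorff.
Qed.

(** The limit rho of the periodic measures has the property by which
    [mirsky_pair] is selected. Its first marginal is the Mirsky measure of
    bstar B, although the latter is defined by other sequences ell: the
    frequencies of eta_star are the same along all of them, being limits of
    those of the lower approximants. *)
Theorem mirsky_pair_spec :
  [/\ Defs.invariant (prod_map sigma sigma) (mirsky_pair R B),
   forall C, clopen C -> period_freq R j`! (lower_approx j, upper_approx j) C
    @[j --> \oo] --> fine (mirsky_pair R B C) &
  forall ell, realizes_lower_density R ell (multiples B) -> forall C, clopen C ->
    freq R (visits C (eta_star B, eta_seq B)) (ell i) @[i --> \oo]
      --> fine (mirsky_pair R B C)].
Proof.
have [rho [rhoI rho_pf rho_freq]] := pair_measure.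
have [rho2 [rho2_pf rho2_freq]] := star_measure.
have cf := @fst_continuous binseq binseq; have cs := @snd_continuous binseq binseq.
have [nu1 nu1E] := marginal rho2 cf; have [nu2 nu2E] := marginal rho cs.
have mirsky2 C : clopen C -> mirsky R B C = nu2 C.
  apply: mirsky_quasi_generic => ell ellP D cD; rewrite nu2E//.
  exact: rho_freq ellP _ (preimage_clopen cD cs).
have mirsky1 C : clopen C -> mirsky R (bstar B) C = nu1 C.
  apply: mirsky_quasi_generic => ell [_ ellI _] D cD; rewrite nu1E//.
  exact: rho2_freq ellI _ (preimage_clopen cD cf).
have fst_rho : is_pushforward (fst : binseq * binseq -> binseq) rho (mirsky R (bstar B)).
  apply: (is_pushforward_clopen resolution_window cf) => C cC.
  have cC' := preimage_clopen cC cf.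
  rewrite mirsky1//; apply: fine_prob_inj; [exact: borel_clopen|exact: borel_clopen|].
  rewrite nu1E//; apply: (cvg_unique _ (rho2_pf _ cC')); first exact: Rhausdorff.
  exact: rho_pf _ cC'.
have snd_rho : is_pushforward (snd : binseq * binseq -> binseq) rho (mirsky R B).
  apply: (is_pushforward_clopen resolution_window cs) => C cC.
  have cC' := preimage_clopen cC cs.
  rewrite mirsky2//; apply: fine_prob_inj; [exact: borel_clopen|exact: borel_clopen|].
  by rewrite nu2E.
pose P := [set rho : probability (borel (binseq * binseq)%type) R |
  joining sigma sigma (mirsky R (bstar B)) (mirsky R B) rho /\
  forall ell, realizes_lower_density R ell (multiples B) ->
    quasi_generic (prod_map sigma sigma) (eta_star B, eta_seq B) ell rho].
have P_rho : P rho.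
  split; first by split.
  move=> ell ellP; apply: (quasi_generic_clopen resolution_pair pair_compact).
  move=> D cD; under eq_fun do rewrite orbit_mean_visits.
  exact: rho_freq.
have [[inv _ _] qg] : P (mirsky_pair R B) by exact: getI P_rho.
have freqs ell : realizes_lower_density R ell (multiples B) -> forall C, clopen C ->
    freq R (visits C (eta_star B, eta_seq B)) (ell i) @[i --> \oo]
      --> fine (mirsky_pair R B C).
  move=> ellP C cC; have := quasi_generic_indic cC (qg ell ellP).
  by under eq_fun do rewrite orbit_mean_visits.
split => // C cC; have [ell ellP] := exists_realizing (multiples B).
exact: (period_freq_lim fact_gt0 approx_pair_periodic cC (approximated_pair ellP)
  (freqs ell ellP C cC)).
Qed.

End approximants.

(** * Points of X_phi between periodic sequences *)

Section residues_and_phi.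
Context (B : set nat) (hB : B `<=` positives).

Lemma set_elem_gt0 (b : B) : (0 < val b)%N.
Proof. by apply: hB; exact: set_valP b. Qed.

Lemma residueD b m n : residue b (m + n) = residue b m + residue b n.
Proof. by rewrite /residue mulrzDr. Qed.

Lemma residue_eq0 b m : (0 < b)%N -> (residue b m == 0) = (b%:Z %| m)%Z.
Proof.
move=> b0; have natE n : (residue b n%:Z == 0) = (b %| n)%N.
  rewrite /residue; change ((inZp 1 : 'I_b.-1.+1) *+ n == 0 = (b %| n)%N).
  rewrite Zp_mulrn -val_eqE /= prednK// modnMml mul1n.
  by rewrite /dvdn.
case: (intP m) => [|n|n]; first by rewrite natE.
  by rewrite natE.
by rewrite /residue mulrNz oppr_eq0 natE dvdzE abszN.
Qed.

Lemma coordinate_nbhs (h : prod_residues B) (b : B) :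
  nbhs h [set g : prod_residues B | g b = h b].
Proof.
have := @proj_continuous B (fun b : B => discrete_topology (residues (val b)))
  b h [set c | c = h b].
by apply; exact: discrete_set1.
Qed.

(** Each coordinate of the translate depends on a single coordinate, with
    values in a discrete space. *)
Lemma translate_continuous n :
  continuous (fun h : prod_residues B => translate h n).
Proof.
move=> h; pose F := nbhs ((fun g : prod_residues B => translate g n) @ h).
have FF : Filter F by apply: fmap_filter; exact: (nbhs_filter h).
suff : F --> translate h n by [].
apply/cvg_sup => b; apply/cvg_image.
  apply/seteqP; split => // c _.
  by exists (dfwith h b c) => //; rewrite dfwithin.
move=> A /nbhs_singleton hA; exists [set y : prod_residues B | A (y b)].
  apply: filterS (coordinate_nbhs h b) => g gb /=.
  by rewrite /translate gb.
apply/seteqP; split=> [_ [y Ay <-//]|c Ac].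
by exists (dfwith h b c); rewrite /= dfwithin.
Qed.

Lemma translate_Delta m n : translate (Delta B m) n = Delta B (m + n).
Proof.
by apply: functional_extensionality_dep => b; rewrite /translate /Delta residueD.
Qed.

Lemma H_group_translate h n : H_group B h -> H_group B (translate h n).
Proof.
move=> Hh U /(@translate_continuous n h U)/Hh[_ [[m _ <-] Um]].
by exists (Delta B (m + n)); split; [exists (m + n)|rewrite -translate_Delta].
Qed.

Lemma H_group_Delta m : H_group B (Delta B m).
Proof. by apply: subset_closure; exists m. Qed.

Lemma phiP h n : H_group B h ->
  phi h n = false <-> exists b : B, translate h n b = 0.
Proof.
move=> Hh; rewrite /phi; split=> [/negP nW|[b hb0]].
  apply: contrapT => /forallNP nb; apply: nW; rewrite inE; split.
    exact: H_group_translate.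
  by move=> b; apply/eqP; exact: nb.
by apply/negbTE/negP; rewrite inE => -[_ /(_ b)]; rewrite hb0 eqxx.
Qed.

Lemma phi_Delta k : phi (Delta B k) = zshift k (eta_seq B).
Proof.
apply/funext => n; rewrite /zshift; apply/idP/idP; last first.
  move/eta_seqP => nM; apply: contraPT I => /negbTE/(phiP _ (@H_group_Delta k)).
  rewrite translate_Delta => -[b] /eqP.
  rewrite residue_eq0 ?set_elem_gt0// addrC => bn.
  by move=> _; apply: nM; exists (val b) => //; exact: set_valP.
move=> h; apply/eta_seqP => -[b Bb bn]; move: h; apply/negP/negbT.
apply/(phiP _ (@H_group_Delta k)); exists (SigSub (mem_set Bb) : B).
by rewrite translate_Delta; apply/eqP; rewrite residue_eq0 ?hB// addrC.
Qed.

Lemma X_eta_sub : X_eta B `<=` X_phi B.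
Proof.
apply: closure_subset => _ [k _ <-]; exists (Delta B k); last exact: phi_Delta.
exact: H_group_Delta.
Qed.

Definition sandwich (w z : binseq) (k : int) : set binseq :=
  [set x | forall n, (w (n + k) -> x n) /\ (x n -> z (n + k))].

Lemma sandwich_closed w z k : closed (sandwich w z k).
Proof.
rewrite -openC openE => x xN.
have [n nP] : exists n, ~ ((w (n + k) -> x n) /\ (x n -> z (n + k))).
  by apply: contrapT => /forallNP h; apply: xN => n; exact: contrapT (h n).
apply: filterS (window_eq_nbhs `|n|%N x) => y xy yS; apply: nP.
by rewrite (xy n (leqnn _)).
Qed.

(** The point h need not determine a residue modulo q, but Delta(Z) is the
    union of the images of q residue classes, and its closure is the union of
    their closures. *)
Lemma H_group_residue_class (q : nat) h : (0 < q)%N -> H_group B h ->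
  exists2 k : nat, (k < q)%N & forall b : B, exists2 m : int,
    (q%:Z %| m - k%:Z)%Z & h b = Delta B m b.
Proof.
move=> q0 Hh; pose F k := closure (Delta B @` [set m : int | (q%:Z %| m - k%:Z)%Z]).
have cU : closed (\bigcup_(k in [set k | (k < q)%N]) F k).
  by apply: closed_bigcup; [exact: finite_II|move=> k _; exact: closed_closure].
have : (\bigcup_(k in [set k | (k < q)%N]) F k) h.
  apply: cU; apply: closure_subset Hh => _ [m _ <-].
  have q00 : q%:Z != 0 by rewrite eqz_nat -lt0n.
  have m0 := modz_ge0 m q00; exists `|(m %% q%:Z)%Z|%N => /=.
    by rewrite -ltz_nat gez0_abs// ltz_pmod// ltz_nat.
  apply: subset_closure; exists m => //=.
  by rewrite gez0_abs// {1}(divz_eq m q%:Z) addrK dvdz_mull.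
move=> [k kq Fh]; exists k => // b.
have [_ [[m mk <-] hb]] := Fh _ (coordinate_nbhs h b).
by exists m.
Qed.

(** The set of the points having this property is closed, so that it is enough
    to consider phi h. Take k as in [H_group_residue_class] for q = j!. A zero
    n of phi h is caused by one coordinate b; an integer m = k modulo j! with
    the same residue modulo b gives eta (m + n) = 0, and w_j (k + n) = w_j (m
    + n) <= eta (m + n). Conversely a zero of z_j at k + n is caused by some b
    dividing j!, so that h and k have the same residue modulo b and phi h
    vanishes at n. *)
Lemma X_phi_sandwich j x : X_phi B x -> exists2 k, (k < j`!)%N &
  sandwich (lower_approx B j) (upper_approx B j) k%:Z x.
Proof.
have cU : closed (\bigcup_(k in [set k | (k < j`!)%N])
    sandwich (lower_approx B j) (upper_approx B j) k%:Z).
  by apply: closed_bigcup; [exact: finite_II|move=> k _; exact: sandwich_closed].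
move=> Xx; suff [k kj kx] : (\bigcup_(k in [set k | (k < j`!)%N])
    sandwich (lower_approx B j) (upper_approx B j) k%:Z) x by exists k.
apply: cU; apply: closure_subset Xx => _ [h Hh <-].
have [k kj hk] := H_group_residue_class (fact_gt0 j) Hh; exists k => // n.
have per (C : set int) m : zperiodic j`! C -> (j`!%:Z %| m - k%:Z)%Z ->
    C (n + m) <-> C (n + k%:Z).
  move=> pC /dvdzP[c mk]; rewrite -(subrK k%:Z m) mk.
  have natper (d : nat) i : C (i + d%:Z * j`!%:Z) <-> C i.
    elim: d => [|d IH]; first by rewrite mul0r addr0.
    by apply: iff_trans IH; rewrite intS mulrDl mul1r addrCA addrC; exact: pC.
  case: (intP c) => [|d|d].
  - by rewrite mul0r add0r.
  - by rewrite addrCA addrC; exact: natper.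
  - apply: iff_sym; have := natper d.+1 (n + (- d.+1%:Z * j`!%:Z + k%:Z)).
    by rewrite (_ : _ + _ * _ = n + k%:Z)//; ring.
split=> [wk|].
  case hE : (phi h n) => //; exfalso; move: hE => /(phiP _ Hh)[b].
  rewrite /translate; have [m mk ->] := hk b; rewrite -residueD => /eqP.
  rewrite residue_eq0 ?set_elem_gt0// addrC => bn.
  have : eta_seq B (n + m).
    apply: eta_star_le => //; apply: (@lower_approx_le B j).
    have pw : zperiodic j`! [set i | lower_approx B j i].
      by move=> i; rewrite /= lower_approx_periodic.
    exact/(per _ _ pw mk).
  by move/eta_seqP; apply; exists (val b) => //; exact: set_valP.
move=> hn; apply/eta_seqP => -[b [Bb bj] bk].
suff : phi h n = false by rewrite hn.
apply/(phiP n Hh).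
exists (SigSub (mem_set Bb) : B); rewrite /translate.
have [m mk ->] := hk (SigSub (mem_set Bb) : B); rewrite -residueD; apply/eqP.
rewrite residue_eq0/= ?hB// addrC.
have bq : (b%:Z %| j`!%:Z)%Z.
  by rewrite dvdzE !absz_nat dvdn_fact// bj andbT; exact: hB.
rewrite (_ : n + m = (n + k%:Z) + (m - k%:Z)); last by ring.
by rewrite rpredD// (dvdz_trans bq).
Qed.

End residues_and_phi.

(** * Coupling an invariant measure with a periodic pair *)

Section real_measure.
Context (R : realType) (X : ptopologicalType) (mu : probability (borel X) R).

Definition mass (A : set X) : R := fine (mu A).

Lemma mass_ge0 A : 0 <= mass A. Proof. exact: fine_ge0. Qed.

Lemma massE A : measurable (A : set (borel X)) -> mu A = (mass A)%:E.
Proof. by move=> mA; rewrite /mass fineK// fin_num_measure. Qed.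

Lemma massT : mass setT = 1. Proof. by rewrite /mass probability_setT. Qed.

Lemma massU A C : measurable (A : set (borel X)) ->
  measurable (C : set (borel X)) -> A `&` C = set0 ->
  mass (A `|` C) = mass A + mass C.
Proof.
by move=> mA mC AC; rewrite /mass measureU// fineD// fin_num_measure.
Qed.

Lemma mass_le A C : measurable (A : set (borel X)) ->
  measurable (C : set (borel X)) -> A `<=` C -> mass A <= mass C.
Proof.
by move=> mA mC AC; rewrite -lee_fin -!massE// le_measure// inE.
Qed.

Lemma mass_le1 A : measurable (A : set (borel X)) -> mass A <= 1.
Proof. by move=> mA; rewrite -massT mass_le. Qed.

Lemma mass_full A C : measurable (A : set (borel X)) ->
  measurable (C : set (borel X)) -> mass C = 1 -> mass (C `&` A) = mass A.
Proof.
move=> mA mC C1; have mnC := measurableC mC.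
have nC0 : mass (~` C) = 0.
  have := massU mC mnC (setICr C); rewrite setUCr massT C1 => e.
  by apply: (addrI (1 : R)); rewrite addr0 -e.
have mAn : measurable (~` C `&` A : set (borel X)) by exact: measurableI.
have mAC : measurable (C `&` A : set (borel X)) by exact: measurableI.
have nCA0 : mass (~` C `&` A) = 0.
  by apply/eqP; rewrite eq_le mass_ge0 andbT -[leRHS]nC0 mass_le// => x [].
rewrite -[in RHS](setTI A) -(setUCr C) setIUl massU// ?nCA0 ?addr0//.
by rewrite setIACA setICr set0I.
Qed.

Definition first_cell (F : nat -> set X) (k : nat) : set X :=
  F k `\` \bigcup_(i in [set i | (i < k)%N]) F i.

Lemma first_cell_measurable F k :
  (forall i, measurable (F i : set (borel X))) ->
  measurable (first_cell F k : set (borel X)).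
Proof. by move=> mF; apply: measurableD => //; exact: bigcup_measurable. Qed.

(** The cells form a partition of the union of the F i. *)
Lemma mass_first_cells F q A : (forall i, measurable (F i : set (borel X))) ->
  measurable (A : set (borel X)) ->
  \sum_(0 <= k < q) mass (first_cell F k `&` A) =
  mass ((\bigcup_(i in [set i | (i < q)%N]) F i) `&` A).
Proof.
move=> mF mA.
have mU n : measurable (\bigcup_(i in [set i | (i < n)%N]) F i : set (borel X)).
  exact: bigcup_measurable.
elim: q => [|q IH].
  rewrite big_geq// (_ : \bigcup_(i in _) _ = set0) ?set0I.
    by rewrite /mass measure0.
  by rewrite -subset0 => x [].
rewrite big_nat_recr//= IH -massU.
- rewrite -setIUl; congr (mass (_ `&` _)).
  apply/seteqP; split=> x.
    move=> [[i /= iq Fi]|[Fq _]]; last by exists q => /=.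
    by exists i => //=; rewrite ltnW.
  move=> [i /= iq Fi]; have [[j jq Fj]|nU] :=
    pselect ((\bigcup_(i in [set i | (i < q)%N]) F i) x); first by left; exists j.
  move: iq; rewrite ltnS leq_eqVlt => /predU1P[iq|iq].
    by right; rewrite -iq; split => //; rewrite iq.
  by left; exists i.
- exact: measurableI.
- by apply: measurableI => //; exact: first_cell_measurable.
- by rewrite -subset0 => x [[Ux _] [[_ nU] _]]; exact: nU.
Qed.

End real_measure.

Notation triple := (binseq * binseq * binseq)%type.

Definition triple_shift : triple -> triple := prod_map (prod_map sigma sigma) sigma.

Lemma resolution_triple : resolution (prod_eq pair_eq window_eq).
Proof. exact: resolution_prod resolution_pair resolution_window. Qed.

Lemma triple_compact : compact [set: triple].
Proof. exact: prod_compact pair_compact binseq_compact. Qed.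

Lemma triple_shift_continuous : continuous triple_shift.
Proof.
apply: prod_map_continuous; last exact: sigma_continuous.
by apply: prod_map_continuous; exact: sigma_continuous.
Qed.

Section averaged_coupling.
Context (R : realType) (mu : probability (borel binseq) R).
Hypothesis mu_inv : Defs.invariant sigma mu.
Context (p : binseq * binseq) (q c : nat).
Hypotheses (q0 : (0 < q)%N) (c0 : (0 < c)%N) (pp : pair_periodic q p).
Hypothesis mu_sandwich :
  mass mu (\bigcup_(k in [set k | (k < q)%N]) sandwich p.1 p.2 k%:Z) = 1.

Let F (k : nat) := sandwich p.1 p.2 k%:Z.
Let mF k : measurable (F k : set (borel binseq)).
Proof. by apply: borel_closed; exact: sandwich_closed. Qed.

Definition coupled (k l : nat) (C : set triple) : set binseq :=
  [set x | C (shift2 (k + l)%N p, zshift l x)].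

Lemma coupled_clopen k l C : clopen C -> clopen (coupled k l C).
Proof.
move=> cC; apply: (@preimage_clopen _ _ (fun x => (shift2 (k + l)%N p, zshift l x))) => //.
apply: (resolution_continuous resolution_window resolution_triple) => n x.
exists (n + l)%N => y xy; split; first by split.
by move=> i /= ni; apply: xy; lia.
Qed.

(** The mass of C under the l-th shift of the coupling that sends a point x of
    the k-th cell to the pair (shift of p by k, x). This law is not invariant,
    whence the average below. *)
Definition coupled_mass (l : nat) (C : set triple) : R :=
  \sum_(0 <= k < q) mass mu (first_cell F k `&` coupled k l C).

(** Averaging over a whole number c of periods makes the first marginal equal
    to the periodic measure of p. The law becomes invariant up to 1 / (q c),
    and exactly so in the limit. *)
Definition averaged_mass (C : set triple) : R :=
  (q * c)%:R^-1 * \sum_(0 <= l < q * c) coupled_mass l C.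

Let mcell k : measurable (first_cell F k : set (borel binseq)).
Proof. exact: first_cell_measurable. Qed.

Let mcoupled k l C : clopen C -> measurable (coupled k l C : set (borel binseq)).
Proof. by move=> cC; apply: borel_clopen; exact: coupled_clopen. Qed.

Lemma mass_zshift (l : nat) (D : set binseq) : clopen D -> mass mu (zshift l @^-1` D) = mass mu D.
Proof.
move=> cD; elim: l => [|l IH].
  by congr (mass mu _); apply/seteqP; split=> x; rewrite /= zshift0.
rewrite -IH /mass [in RHS]mu_inv; last first.
  by apply: borel_clopen; apply: preimage_clopen cD _; exact: zshift_continuous.
congr (fine (mu _)); apply/seteqP; split=> x; rewrite /= /sigma zshiftD.
  by rewrite -PoszD addn1.
by rewrite -PoszD addn1.
Qed.

Lemma coupled_mass_total (l : nat) (C : set triple) (D : set binseq) : clopen D ->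
  (forall k x, F k x -> C (shift2 (k + l)%N p, zshift l x) <-> D (zshift l x)) ->
  coupled_mass l C = mass mu D.
Proof.
move=> cD CD.
rewrite /coupled_mass (eq_bigr (fun k => mass mu (first_cell F k `&` (zshift l @^-1` D)))).
  have mD : measurable (zshift l @^-1` D : set (borel binseq)).
    by apply: borel_clopen; apply: preimage_clopen cD _; exact: zshift_continuous.
  rewrite mass_first_cells// mass_full//; first exact: mass_zshift.
  exact: bigcup_measurable.
move=> k _; congr (mass mu _); apply/seteqP; split=> x [[Fk nF] h]; split => //.
  exact/(CD k x Fk).
exact/(CD k x Fk).
Qed.

Lemma averaged_mass_total (C : set triple) (D : set binseq) : clopen D ->
  (forall k l x, F k x -> C (shift2 (k + l)%N p, zshift l x) <-> D (zshift l x)) ->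
  averaged_mass C = mass mu D.
Proof.
move=> cD CD; rewrite /averaged_mass (eq_bigr (fun _ => mass mu D)).
  rewrite sumr_const_nat subn0 -[X in _ * X]mulr_natl mulrA mulVf ?mul1r//.
  by rewrite pnatr_eq0 -lt0n muln_gt0 q0.
by move=> l _; apply: coupled_mass_total => // k x; exact: CD.
Qed.

Lemma averaged_massT : averaged_mass setT = 1.
Proof. by rewrite (@averaged_mass_total setT setT) ?massT//; exact: clopenT. Qed.

Lemma averaged_mass_snd (D : set binseq) : clopen D ->
  averaged_mass (snd @^-1` D) = mass mu D.
Proof. by move=> cD; exact: averaged_mass_total. Qed.

(** On the k-th cell the third coordinate lies between the first two, so that
    mixing them according to it gives it back. *)
Lemma averaged_mass_mix (D : set binseq) : clopen D ->
  averaged_mass (mix @^-1` D) = mass mu D.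
Proof.
move=> cD; apply: averaged_mass_total => // k l x Fk.
suff -> : (mix @^-1` D) (shift2 (k + l)%N p, zshift l x) = D (zshift l x) by [].
congr D; apply/funext => n; rewrite /mix/= /zshift.
have [wx xz] := Fk (n + l%:Z).
have E : n + (k + l)%N%:Z = n + l%:Z + k%:Z by rewrite PoszD; ring.
rewrite E; case: ifP => [/xz ->//|].
by move=> nx; apply/negbTE/negP => /wx; rewrite nx.
Qed.

Lemma averaged_mass_ge0 C : 0 <= averaged_mass C.
Proof.
rewrite mulr_ge0 ?invr_ge0// sumr_ge0// => l _; apply: sumr_ge0 => k _.
exact: mass_ge0.
Qed.

Lemma averaged_massU A C : clopen A -> clopen C -> A `&` C = set0 ->
  averaged_mass (A `|` C) = averaged_mass A + averaged_mass C.
Proof.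
move=> cA cC AC; rewrite -mulrDr -big_split/=; congr (_ * _).
apply: eq_bigr => l _; rewrite -big_split/=; apply: eq_bigr => k _.
rewrite -massU; [|by apply: measurableI => //; exact: mcoupled..|].
  by rewrite -setIUr.
rewrite setIACA setIid (_ : coupled k l A `&` coupled k l C = set0) ?setI0//.
rewrite -subset0 => x [Ax Cx].
by have : (A `&` C) (shift2 (k + l)%N p, zshift l x) by []; rewrite AC.
Qed.

Lemma coupled_mass_le1 l C : clopen C -> coupled_mass l C <= 1.
Proof.
move=> cC; rewrite -(massT mu).
rewrite -(@coupled_mass_total l setT setT)//; last exact: clopenT.
apply: ler_sum => k _; apply: mass_le.
- by apply: measurableI => //; exact: mcoupled.
- by apply: measurableI => //; apply: mcoupled; exact: clopenT.
- by move=> x [].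
Qed.

Lemma averaged_mass_shift C : clopen C ->
  `|averaged_mass (triple_shift @^-1` C) - averaged_mass C| <= (q * c)%:R^-1.
Proof.
move=> cC; have L0 : (0 < q * c)%N by rewrite muln_gt0 q0.
have step l : coupled_mass l (triple_shift @^-1` C) = coupled_mass l.+1 C.
  apply: eq_bigr => k _; congr (mass mu (_ `&` _)); apply/seteqP.
  have E x : triple_shift (shift2 (k + l)%N p, zshift l x) =
      (shift2 (k + l.+1)%N p, zshift l.+1 x).
    rewrite /triple_shift /prod_map /= /shift2 /sigma !zshiftD.
    by rewrite -!PoszD addnS !add1n.
  by split=> x; rewrite /coupled/= E.
rewrite /averaged_mass -mulrBr normrM ger0_norm ?invr_ge0//.
rewrite -[leRHS]mulr1 ler_wpM2l ?invr_ge0//.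
rewrite (eq_bigr (fun l => coupled_mass l.+1 C)); last by move=> l _; exact: step.
have [M ME] : exists M, (q * c = M.+1)%N by exists (q * c).-1; rewrite prednK.
rewrite ME big_nat_recr//= [X in _ - X]big_nat_recl//= opprD addrACA.
rewrite [X in `|X|](_ : _ = coupled_mass M.+1 C - coupled_mass 0 C); last by ring.
have c0' l : 0 <= coupled_mass l C by apply: sumr_ge0 => k _; exact: mass_ge0.
have := coupled_mass_le1 0 cC; have := coupled_mass_le1 M.+1 cC.
by have := c0' 0%N; have := c0' M.+1; rewrite ler_norml => *; apply/andP; split; lra.
Qed.

(** On the k-th cell the pair runs c times through the orbit of p, whatever
    its starting point k. *)
Lemma averaged_mass_fst (C : set (binseq * binseq)) : clopen C ->
  averaged_mass (fst @^-1` C) = period_freq R q p C.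
Proof.
move=> cC; rewrite /averaged_mass /coupled_mass exchange_big/=.
have qR : q%:R != 0 :> R by rewrite pnatr_eq0 -lt0n.
have cR : c%:R != 0 :> R by rewrite pnatr_eq0 -lt0n.
have per := visits_zperiodic C pp.
have inner k : \sum_(0 <= l < q * c) mass mu (first_cell F k `&`
      coupled k l (fst @^-1` C)) =
    mass mu (first_cell F k) * ((q * c)%:R * period_freq R q p C).
  rewrite (eq_bigr (fun l => mass mu (first_cell F k) *
      indz R (visits C p) (l + k)%N)); last first.
    move=> l _; rewrite /indz; have [/set_mem h|/negP h] := boolP (_ \in _).
      rewrite mulr1; congr (mass mu _); apply/seteqP; split=> x; first by case.
      by move=> Fk; split => //; rewrite /coupled /= addnC.
    rewrite mulr0 (_ : _ `&` _ = set0) ?/mass ?measure0//.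
    rewrite -subset0 => x [_ Cx]; apply: h; rewrite inE.
    by move: Cx; rewrite /coupled/= addnC.
  rewrite -mulr_sumr; congr (_ * _).
  have pq := nperiodic_mul c (zperiodic_indz R per).
  rewrite [X in X = _](_ : _ = \sum_(1 <= l < (q * c).+1)
      indz R (visits C p) (l + k)%N).
    rewrite (psum_shift k pq) psum_period; last exact: zperiodic_indz.
    by rewrite /period_freq natrM; field.
  have L0 : (0 < q * c)%N by rewrite muln_gt0 q0.
  have [M ME] : exists M, (q * c = M.+1)%N by exists (q * c).-1; rewrite prednK.
  rewrite [RHS]big_add1 /= ME big_nat_recl//= [RHS]big_nat_recr//= addrC.
  congr (_ + _); rewrite -ME -(pq k) addnC.
  by congr (indz R _ _).
rewrite (eq_bigr (fun k => mass mu (first_cell F k) *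
  ((q * c)%:R * period_freq R q p C))) => [|k _]; last exact: inner.
rewrite -mulr_suml.
have := coupled_mass_total (l := 0%N) (C := setT) (D := setT) clopenT.
rewrite /coupled_mass massT => /(_ (fun _ _ _ => iff_refl _)).
rewrite (eq_bigr (fun k => mass mu (first_cell F k))); last first.
  by move=> k _; rewrite /coupled setIT.
move=> ->; rewrite mul1r mulrA mulVf ?mul1r//.
by rewrite pnatr_eq0 -lt0n muln_gt0 q0.
Qed.

End averaged_coupling.

(** * Joinings and mixtures *)

Section ultralimits.
Context (R : realType).

Lemma ultra_bounded_cvg (U : set_system nat) (a : nat -> R) : UltraFilter U ->
  (forall j, 0 <= a j <= 1) -> cvg (a j @[j --> U]).
Proof.
move=> UU a01; have PU : ProperFilter U by exact: ultra_proper.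
have Fa : (a j @[j --> U]) `[0, 1]%classic.
  by apply: (@filterS _ U _ setT) filterT => j _ /=; rewrite in_itv/=.
have [l [_ cl]] := segment_compact (fmap_proper_filter a PU) Fa.
apply/cvg_ex; exists l => V /= lV.
have [//|nV] := in_ultra_setVsetC (a @^-1` V) UU.
by have [y [nVy Vy]] := cl (~` V) V nV lV.
Qed.

(** An ultrafilter provides limits for all clopen sets at once, without
    extracting subsequences. *)
Lemma exists_free_ultrafilter :
  exists U : set_system nat, UltraFilter U /\ \oo `<=` U.
Proof. exact: ultraFilterLemma. Qed.

End ultralimits.

Section coupling.
Context (R : realType) (B : set nat) (hB : B `<=` positives).
Hypothesis hreg : regular_toeplitz R (eta_star B).

(** The limit of the averaged couplings with the pairs (w_j, z_j). Averaging
    over j! (j + 1) steps makes it invariant, and the masses of the preimages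
    under the two projections and under [mix] are known before the limit is
    taken. *)
Theorem X_phi_coupling (mu : probability (borel binseq) R) :
  invariant_measures R (X_phi B) mu ->
  exists lambda : probability (borel triple) R,
    joining (prod_map sigma sigma) sigma (mirsky_pair R B) mu lambda /\
    is_pushforward mix lambda mu.
Proof.
move=> [mu_inv muX].
pose p j := (lower_approx B j, upper_approx B j).
have pp j : pair_periodic j`! (p j) by exact: approx_pair_periodic.
have F0 := fact_gt0.
have mu_sw j : mass mu (\bigcup_(k in [set k | (k < j`!)%N])
    sandwich (p j).1 (p j).2 k%:Z) = 1.
  have mS : measurable (\bigcup_(k in [set k | (k < j`!)%N])
      sandwich (p j).1 (p j).2 k%:Z : set (borel binseq)).
    apply: bigcup_measurable => k _; apply: borel_closed.
    exact: sandwich_closed.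
  apply/eqP; rewrite eq_le mass_le1//=.
  have X1 : mass mu (X_phi B) = 1 by rewrite /mass muX.
  rewrite -[leLHS]X1; apply: mass_le => //.
    by apply: borel_closed; exact: closed_closure.
  by move=> x /(X_phi_sandwich hB j)[k kj Sk]; exists k.
pose a j C := averaged_mass mu (p j) j`! j.+1 C.
have a_ge0 j C : 0 <= a j C by exact: averaged_mass_ge0.
have a_U j A C : clopen A -> clopen C -> A `&` C = set0 ->
    a j (A `|` C) = a j A + a j C by exact: averaged_massU.
have a_T j : a j setT = 1 by exact: averaged_massT.
have a_01 j C : clopen C -> 0 <= a j C <= 1.
  move=> cC; rewrite a_ge0/= -(a_T j) -(setUCr C) a_U ?setICr ?lerDl//.
  exact: clopenC.
have [U [UU ooU]] := exists_free_ultrafilter.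
have PU : ProperFilter U by exact: ultra_proper.
have cvU C : clopen C -> cvg (a j C @[j --> U]).
  by move=> cC; apply: ultra_bounded_cvg => j; exact: a_01.
pose m C : R := lim (a j C @[j --> U]).
have mE C l : a j C @[j --> U] --> l -> m C = l by move=> h; exact/cvg_lim.
have m_ge0 C : clopen C -> 0 <= m C.
  by move=> /cvU cC; apply: limr_ge => //; apply: nearW => j.
have mT : m setT = 1.
  by apply: mE; under eq_fun do rewrite a_T; exact: cvg_cst.
have mU A C : clopen A -> clopen C -> A `&` C = set0 -> m (A `|` C) = m A + m C.
  move=> cA cC AC; apply: mE; under eq_fun do rewrite a_U//.
  by apply: cvgD; [exact: cvU|exact: cvU].
have [lambda lambdaE] := clopen_extension resolution_triple triple_compact m_ge0 mT mU.
exists lambda.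
have fst_c : continuous (fst : triple -> binseq * binseq) by exact: fst_continuous.
have snd_c : continuous (snd : triple -> binseq) by exact: snd_continuous.
have [_ mp_lim _] := mirsky_pair_spec hB hreg.
split; first split.
- apply: (is_pushforward_clopen resolution_triple triple_shift_continuous) => C cC.
  have cC' := preimage_clopen cC triple_shift_continuous.
  rewrite !lambdaE//; congr (_%:E); symmetry; apply: mE.
  rewrite (_ : (fun j => _) = (fun j => a j C +
    (a j (triple_shift @^-1` C) - a j C))); last first.
    by apply/funext => j; rewrite subrKC.
  rewrite -[X in _ --> X]addr0; apply: cvgD; first exact: cvU.
  apply: cvg_trans (_ : a j (triple_shift @^-1` C) - a j C @[j --> \oo] --> 0).
    by apply: cvg_app; exact: ooU.
  apply/cvgrPdist_le => e e0; near=> j.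
  rewrite sub0r normrN.
  apply: (le_trans (averaged_mass_shift mu_inv (F0 j) (ltn0Sn j) (mu_sw j) cC)).
  rewrite -[leRHS]invrK lef_pV2 ?posrE ?invr_gt0// ?ltr0n ?muln_gt0 ?F0//.
  apply: (@le_trans _ _ j%:R).
    by near: j; exact: nbhs_infty_ger.
  by rewrite ler_nat; apply: (@leq_trans j.+1) => //; rewrite leq_pmull.
- apply: (is_pushforward_clopen resolution_pair fst_c) => C cC.
  have cC' := preimage_clopen cC fst_c.
  rewrite lambdaE// (massE _ (borel_clopen cC)); congr (_%:E); symmetry; apply: mE.
  under eq_fun do rewrite /a averaged_mass_fst//.
  apply: cvg_trans (mp_lim C cC); by apply: cvg_app; exact: ooU.
- apply: (is_pushforward_clopen resolution_window snd_c) => C cC.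
  have cC' := preimage_clopen cC snd_c.
  rewrite lambdaE// (massE _ (borel_clopen cC)); congr (_%:E); symmetry; apply: mE.
  under eq_fun do rewrite /a averaged_mass_snd//.
  exact: cvg_cst.
- apply: (is_pushforward_clopen resolution_window mix_continuous) => C cC.
  have cC' := preimage_clopen cC mix_continuous.
  rewrite lambdaE// (massE _ (borel_clopen cC)); congr (_%:E); symmetry; apply: mE.
  under eq_fun do rewrite /a averaged_mass_mix//.
  exact: cvg_cst.
Unshelve. all: by end_near.
Qed.

Definition between_pattern (n : nat) (y : binseq) : set (binseq * binseq) :=
  [set q | forall i : int, (`|i| <= n)%N -> y i = q.1 i \/ y i = q.2 i].

Lemma between_pattern_saturated n y : saturated pair_eq n (between_pattern n y).
Proof. by move=> q q' [e1 e2] Dq i ni; rewrite -e1// -e2//; exact: Dq. Qed.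

(** If the mass were positive, the pattern y would be attained between
    eta_star and eta with positive frequency, and it would occur in eta by
    [pattern_occurs]. *)
Lemma between_pattern_mass0 n y : window_eq n y `&` X_eta B = set0 ->
  mass (mirsky_pair R B) (between_pattern n y) = 0.
Proof.
move=> yX; set D := between_pattern n y.
have cD : clopen D.
  apply: (saturated_clopen resolution_pair (n := n)).
  exact: between_pattern_saturated.
have [_ _ mp_freq] := mirsky_pair_spec hB hreg.
have [ell ellP] := exists_realizing R (multiples B).
apply/eqP; rewrite eq_le mass_ge0 andbT leNgt; apply/negP => c0.
have cvD := mp_freq ell ellP D cD.
have DE : visits D (eta_star B, eta_seq B) = attained_patterns B n y.
  apply/seteqP; split=> k h i ni; have := h i ni; rewrite /= /zshift addrC;
    by case; [left|right].
have cc : mass (mirsky_pair R B) D / 2 < mass (mirsky_pair R B) D.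
  by move: c0; move: (mass _ _) => c; lra.
have [N _ hN] := cvgr_gt _ cvD _ cc.
have [ell0 ellI _] := ellP.
have [|m mP] := pattern_occurs hB ellP (bstar_tail hB hreg ell0 ellI)
  (divr_gt0 c0 (ltr0n R 2)) (n := n) (v := y).
  by exists N => // i Ni; rewrite -DE ltW//; exact: hN.
have : (window_eq n y `&` X_eta B) (zshift m (eta_seq B)).
  split; last by apply: subset_closure; exists m.
  by move=> i ni; rewrite /zshift addrC mP.
by rewrite yX.
Qed.

(** D is a union of finitely many cells. *)
Lemma mass_cells0 (mu : probability (borel binseq) R) n (D : set binseq) :
  saturated window_eq n D -> (forall y, D y -> mass mu (window_eq n y) = 0) ->
  mass mu D = 0.
Proof.
have [s sX] := finite_cells resolution_window binseq_compact n.
move=> sD D0; have {sX} : forall y, D y -> exists2 z, z \in s & window_eq n z y.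
  by move=> y _; exact: sX.
elim: s D sD D0 => [|z s IH] D sD D0 Ds.
  rewrite (_ : D = set0) ?/mass ?measure0//.
  by rewrite -subset0 => y /Ds[].
have sz := saturated_cell resolution_window (n := n) (x := z).
have mD A : saturated window_eq n A -> measurable (A : set (borel binseq)).
  by move=> sA; apply: borel_clopen; exact: (saturated_clopen resolution_window sA).
have sDz := saturatedI sD sz.
have sDnz := saturatedI sD (saturatedC resolution_window sz).
rewrite -(setIT D) -(setUCr (window_eq n z)) setIUr massU; last 3 first.
- exact: mD.
- exact: mD.
- by rewrite setIACA setICr setI0.
rewrite [X in _ + X]IH ?addr0//; last 2 first.
- by move=> y [/D0].
- move=> y [/Ds[w + wy] nzy]; rewrite inE => /predU1P[wz|ws]; last by exists w.
  by exfalso; apply: nzy; rewrite -wz.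
have [[y [Dy zy]]|/forallNP nD] := pselect (exists y, (D `&` window_eq n z) y).
  apply/eqP; rewrite eq_le mass_ge0 andbT -[leRHS](D0 y Dy).
  have sy := saturated_cell resolution_window (n := n) (x := y).
  apply: mass_le; [exact: mD|exact: mD|].
  move=> x [_ zx]; exact: (res_trans resolution_window (res_sym resolution_window zy) zx).
by rewrite (_ : D `&` _ = set0) ?/mass ?measure0// -subset0 => y /nD.
Qed.

(** The complement of X_eta is a countable union of cells that do not meet
    X_eta. The value of a mixture lies between those of the first two
    sequences, so that the mass of such a cell is at most the mass of
    [between_pattern], which vanishes. *)
Theorem mix_joining_X_eta (mu kappa : probability (borel binseq) R)
    (lambda : probability (borel triple) R) :
  joining (prod_map sigma sigma) sigma (mirsky_pair R B) kappa lambda ->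
  is_pushforward mix lambda mu -> invariant_measures R (X_eta B) mu.
Proof.
move=> [lam_inv lam_fst _] lam_mix; split.
  move=> A mA; have mA' := borel_preimage sigma_continuous mA.
  rewrite /pushforward [RHS]lam_mix// lam_mix// /pushforward.
  rewrite [LHS]lam_inv; last exact: borel_preimage mix_continuous _ mA.
  by congr (lambda _).
have mX : measurable (X_eta B : set (borel binseq)).
  by apply: borel_closed; exact: closed_closure.
have oX : open (~` X_eta B) by rewrite openC; exact: closed_closure.
suff nX0 : mu (~` X_eta B) = 0%E.
  by have := probability_setC mu mX; rewrite nX0 (massE _ mX) => /eqP;
    rewrite eq_sym -EFinB eqe subr_eq0 => /eqP <-.
apply/eqP; rewrite eq_le measure_ge0 andbT.
rewrite {1}(bigcup_inner_part resolution_window oX).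
have mc n : measurable (inner_part window_eq n (~` X_eta B) : set (borel binseq)).
  apply: borel_clopen; apply: (saturated_clopen resolution_window (n := n)).
  exact: (inner_part_saturated resolution_window).
apply: le_trans (generalized_Boole_inequality mu mc _) _.
  exact: bigcupT_measurable.
rewrite eseries0// => n _ _; rewrite [LHS](massE _ (mc n)); congr (_%:E).
apply: (@mass_cells0 _ n); first exact: (inner_part_saturated resolution_window).
move=> y yX.
have m1 : measurable (window_eq n y : set (borel binseq)).
  have sy := saturated_cell resolution_window (n := n) (x := y).
  by apply: borel_clopen; exact: (saturated_clopen resolution_window sy).
have cD : clopen (between_pattern n y).
  apply: (saturated_clopen resolution_pair (n := n)).
  exact: between_pattern_saturated.
apply/eqP; rewrite eq_le mass_ge0 andbT.
rewrite -(between_pattern_mass0 (n := n) (y := y)); last first.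
  by rewrite -subset0 => x [/yX].
rewrite /mass lam_mix// lam_fst; last exact: borel_clopen.
apply: mass_le.
- exact: borel_preimage mix_continuous _ m1.
- by apply: borel_clopen; apply: preimage_clopen cD _; exact: fst_continuous.
- move=> [q x] /= h i ni; rewrite h// /mix/=.
  by case: ifP => _; [right|left].
Qed.

End coupling.

Theorem theoremB (R : realType) (B : set nat) (hB : B `<=` positives)
    (hreg : regular_toeplitz R (eta_star B)) :
  invariant_measures R (X_eta B) = invariant_measures R (X_phi B) /\
  invariant_measures R (X_phi B) =
    [set mu : probability (borel binseq) R |
      exists kappa : probability (borel binseq) R,
        invariant_measures R [set: binseq] kappa /\
      exists lambda : probability (borel (binseq * binseq * binseq)%type) R,
        joining (prod_map sigma sigma) sigma (mirsky_pair R B) kappa lambda /\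
        is_pushforward mix lambda mu].
Proof.
have eta_phi : invariant_measures R (X_eta B) `<=` invariant_measures R (X_phi B).
  move=> mu [mu_inv muX]; split => //.
  have mXe : measurable (X_eta B : set (borel binseq)).
    by apply: borel_closed; exact: closed_closure.
  have mXp : measurable (X_phi B : set (borel binseq)).
    by apply: borel_closed; exact: closed_closure.
  apply/eqP; rewrite eq_le probability_le1//= -muX le_measure ?inE//.
  exact: X_eta_sub.
set RHS := (X in _ /\ _ = X).
have phi_mix : invariant_measures R (X_phi B) `<=` RHS.
  move=> mu /[dup] -[mu_inv _] /(X_phi_coupling hB hreg) lambdaP.
  by exists mu; split => //; split => //; exact: probability_setT.
have mix_eta : RHS `<=` invariant_measures R (X_eta B).
  move=> mu [kappa [_ [lambda [J M]]]].
  exact: (mix_joining_X_eta hB hreg J M).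
split; apply/seteqP; split => //.
  exact: subset_trans phi_mix mix_eta.
exact: subset_trans mix_eta eta_phi.
Qed.
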